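(* If $\mathbb K$ is a computable age, then its embedding information satisfies $\mathscr{EI}(\mathbb K)\leq_{\mathrm T}\mathbf{0'}$. Further, if $\mathbb K$ is a uniformly finite computable age, then $\mathscr{EI}(\mathbb K)$ is computable.
   Context: Languages and structures. $\mathcal{L}$ is a countable language (relation symbols of positive arity; function symbols of any arity, 0-ary ones being constants) with a computable representation: relation symbols $R_n$ and function symbols $F_m$ are indexed bijectively by disjoint computable subsets of $\omega$, with arity computable from the index. An $\mathcal{L}$-structure $\mathcal{M}$ is c.e. if its underlying set $M$ is a c.e. subset of $\omega$ and the sets $\{(n,\mathbf a): \mathcal M\models R_n(\mathbf a)\}$, $\{(n,\mathbf a): \mathcal M\models \neg R_n(\mathbf a)\}$, $\{(m,\mathbf a,b): \mathcal M\models F_m(\mathbf a)=b\}$ are c.e.; it is computable if moreover $M$ is computable. Tuples are finite; $\mathrm{cl}_{\mathcal M}(\mathbf a)$ is the smallest substructure of $\mathcal M$ containing $\mathbf a$. For $\mathbf a\in\mathcal A$, $\mathbf b\in\mathcal B$ of the same length, $\mathbf a\simeq\mathbf b$ means that for every atomic $\mathcal L$-formula $\varphi$, $\mathcal A\models\varphi(\mathbf a)$ iff $\mathcal B\models\varphi(\mathbf b)$; equivalently $\mathbf a\mapsto\mathbf b$ extends to an isomorphism $\mathrm{cl}(\mathbf a)\to\mathrm{cl}(\mathbf b)$. $\mathbf{0'}$ is the Turing jump of the least Turing degree. Ages. An age is a collection of finitely generated $\mathcal L$-structures closed under isomorphism. A computable age (computable representation of an age $\mathcal K$) is a c.e. set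 $\mathbb K$ of triples $(\mathbf a,\mathcal A,i)$ (computable structures being given by indices), with exactly one triple for each $i\in\omega$, written $\mathbb I(i)=(\mathbf a_i,\mathcal A_i,i)$, such that each $\mathcal A_i$ is a computable $\mathcal L$-structure in $\mathcal K$ with $\mathcal A_i=\mathrm{cl}_{\mathcal A_i}(\mathbf a_i)$, and every $\mathcal B\in\mathcal K$ is isomorphic to some $\mathcal A_i$. The embedding information $\mathscr{EI}(\mathbb K)$ is the set of tuples $(\mathbb I(k_0),\mathbf b_0,\mathbb I(k_1),\mathbf b_1)$ with $\mathbf b_0\in\mathcal A_{k_0}$, $\mathbf b_1\in\mathcal A_{k_1}$ and $\mathbf b_0\simeq\mathbf b_1$. A collection $\mathcal K$ of $\mathcal L$-structures is uniformly finite if $\mathcal L$ is a finite language and there is a computable function $f:\omega\to\omega$ such that for all $\mathcal M\in\mathcal K$ and all tuples $\mathbf a\in\mathcal M$ we have $|\mathrm{cl}_{\mathcal M}(\mathbf a)|\leq f(|\mathbf a|)$. *)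

(* Defs.v *)
From Stdlib Require Import Arith List Lia Cantor.
Import ListNotations.

Set Implicit Arguments.
Unset Strict Implicit.

Definition pair_code (x y : nat) : nat := Cantor.to_nat (x, y).

Fixpoint list_code (l : list nat) : nat :=
  match l with
  | [] => 0
  | x :: l' => S (pair_code x (list_code l'))
  end.

(* Programs for Kleene's partial recursive functions with an oracle.  All
   functions are unary; several arguments are passed as one coded pair. *)
Inductive code : Set :=
| Czero
| Csucc
| Cfst
| Csnd
| Coracle
| Cpair (c d : code)
| Ccomp (c d : code)
| Cprec (c d : code)
| Cmu (c : code).

(* [eval O c x y]: program [c] with oracle the set [O] halts on input [x] with
   output [y].  [Cprec c d] is the function h with h<n,0> = c(n) and
   h<n,k+1> = d<n,<k,h<n,k>>>; [Cmu c] maps x to the least y with c<x,y> = 0,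
   and converges only if c<x,k> converges for every k below y. *)
Fixpoint eval (O : nat -> Prop) (c : code) (x y : nat) {struct c} : Prop :=
  match c with
  | Czero => y = 0
  | Csucc => y = S x
  | Cfst => y = fst (Cantor.of_nat x)
  | Csnd => y = snd (Cantor.of_nat x)
  | Coracle => (O x /\ y = 1) \/ (~ O x /\ y = 0)
  | Cpair c d => exists u v, eval O c x u /\ eval O d x v /\ y = pair_code u v
  | Ccomp c d => exists u, eval O d x u /\ eval O c u y
  | Cprec c d =>
      let n := fst (Cantor.of_nat x) in
      nat_rect (fun _ => nat -> Prop)
        (fun z => eval O c n z)
        (fun k h z =>
           exists w, h w /\ eval O d (pair_code n (pair_code k w)) z)
        (snd (Cantor.of_nat x)) y
  | Cmu c =>
      eval O c (pair_code x y) 0 /\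
      forall k, k < y -> exists z, eval O c (pair_code x k) (S z)
  end.

(* Goedel numbering; numbers outside its range index the empty function. *)
Fixpoint code_num (c : code) : nat :=
  match c with
  | Czero => 0
  | Csucc => 1
  | Cfst => 2
  | Csnd => 3
  | Coracle => 4
  | Cpair c d => 5 + 4 * pair_code (code_num c) (code_num d)
  | Ccomp c d => 6 + 4 * pair_code (code_num c) (code_num d)
  | Cprec c d => 7 + 4 * pair_code (code_num c) (code_num d)
  | Cmu c => 8 + 4 * code_num c
  end.

Lemma pair_code_inj (x y x' y' : nat) :
  pair_code x y = pair_code x' y' -> x = x' /\ y = y'.
Proof.
  unfold pair_code; intros H; apply Cantor.to_nat_inj in H.
  now injection H.
Qed.

Lemma code_num_inj (c d : code) : code_num c = code_num d -> c = d.
Proof.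
  revert d; induction c; intros []; cbn [code_num]; intros H;
    try reflexivity; try (exfalso; lia).
  4: now f_equal; apply IHc; lia.
  all: match type of H with _ = _ + 4 * ?q =>
         match type of H with _ + 4 * ?p = _ =>
           assert (E : p = q) by lia end end;
       apply pair_code_inj in E; destruct E; f_equal; auto.
Qed.

Definition empty_set : nat -> Prop := fun _ => False.

Definition phi (O : nat -> Prop) (e x y : nat) : Prop :=
  exists c, code_num c = e /\ eval O c x y.

(* [e] is an index, relative to [O], of the characteristic function of [S]. *)
Definition decides (O : nat -> Prop) (e : nat) (S : nat -> Prop) : Prop :=
  forall n, (S n -> phi O e n 1) /\ (~ S n -> phi O e n 0).

(* [e] is a c.e. index of [S]: [S] is the domain of the [e]-th function. *)
Definition enumerates (e : nat) (S : nat -> Prop) : Prop :=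
  forall n, S n <-> exists m, phi empty_set e n m.

Definition turing_le (A B : nat -> Prop) : Prop := exists e, decides B e A.

Definition computable (A : nat -> Prop) : Prop :=
  exists e, decides empty_set e A.

Definition ce (A : nat -> Prop) : Prop := exists e, enumerates e A.

Definition computable_fun (f : nat -> nat) : Prop :=
  exists e, forall n, phi empty_set e n (f n).

Definition jump (O : nat -> Prop) : nat -> Prop :=
  fun e => exists y, phi O e e y.

Definition zero_jump : nat -> Prop := jump empty_set.

(* A symbol is identified with its index; 0-ary function symbols are the
   constants.  [arity] is junk outside the two sets of indices. *)
Record language : Type := {
  relsym : nat -> Prop;
  funsym : nat -> Prop;
  arity : nat -> nat;
  relsym_computable : computable relsym;
  funsym_computable : computable funsym;
  sym_disjoint : forall n, relsym n -> funsym n -> False;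
  arity_computable :
    exists e, forall n, relsym n \/ funsym n -> phi empty_set e n (arity n);
  relsym_arity_pos : forall n, relsym n -> 0 < arity n
}.

(* A structure has as underlying set a subset [dom] of the type [U].  Functions
   are interpreted by their graphs.  The empty structure is allowed (when there
   are no constants). *)
Record structure (L : language) (U : Type) : Type := {
  dom : U -> Prop;
  rel_int : nat -> list U -> Prop;
  fun_int : nat -> list U -> U -> Prop;
  rel_int_dom : forall n a, rel_int n a ->
    relsym L n /\ length a = arity L n /\ Forall dom a;
  fun_int_dom : forall m a b, fun_int m a b ->
    funsym L m /\ length a = arity L m /\ Forall dom a /\ dom b;
  fun_int_total : forall m a,
    funsym L m -> length a = arity L m -> Forall dom a ->
    exists! b, fun_int m a b
}.

Definition substructure (L : language) (U : Type) (M : structure L U)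
    (S : U -> Prop) : Prop :=
  (forall x, S x -> dom M x) /\
  (forall m a b, Forall S a -> fun_int M m a b -> S b).

(* The smallest substructure containing the tuple [a] of elements of [M]. *)
Definition cl (L : language) (U : Type) (M : structure L U) (a : list U)
    (x : U) : Prop :=
  forall S, substructure M S -> Forall S a -> S x.

Definition generates (L : language) (U : Type) (M : structure L U)
    (a : list U) : Prop :=
  Forall (dom M) a /\ forall x, dom M x <-> cl M a x.

Definition finitely_generated (L : language) (U : Type) (M : structure L U) :
    Prop :=
  exists a, generates M a.

(* Isomorphisms are given by their graphs, so that the ambient types [U] and
   [V] play no role. *)
Record isomorphism (L : language) (U V : Type) (A : structure L U)
    (B : structure L V) (f : U -> V -> Prop) : Prop := {
  iso_dom : forall x y, f x y -> dom A x /\ dom B y;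
  iso_fun : forall x, dom A x -> exists! y, f x y;
  iso_bij : forall y, dom B y -> exists! x, f x y;
  iso_rel : forall n a b, relsym L n -> Forall2 f a b ->
    (rel_int A n a <-> rel_int B n b);
  iso_op : forall m a b x y, funsym L m -> Forall2 f a b -> f x y ->
    (fun_int A m a x <-> fun_int B m b y)
}.

Definition isomorphic (L : language) (U V : Type) (A : structure L U)
    (B : structure L V) : Prop :=
  exists f, isomorphism A B f.

Inductive term : Set :=
| Tvar (i : nat)
| Tapp (m : nat) (ts : list term).

Inductive atomic : Set :=
| Arel (n : nat) (ts : list term)
| Aeq (s t : term).

(* [L]-terms in the variables x_0, ..., x_(k-1). *)
Inductive wf_term (L : language) (k : nat) : term -> Prop :=
| wf_var i : i < k -> wf_term L k (Tvar i)
| wf_app m ts : funsym L m -> length ts = arity L m ->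
    (forall t, In t ts -> wf_term L k t) -> wf_term L k (Tapp m ts).

Definition wf_atomic (L : language) (k : nat) (p : atomic) : Prop :=
  match p with
  | Arel n ts =>
      relsym L n /\ length ts = arity L n /\ (forall t, In t ts -> wf_term L k t)
  | Aeq s t => wf_term L k s /\ wf_term L k t
  end.

(* [value M a t x]: the term [t] takes the value [x] under x_i := a_i. *)
Inductive value (L : language) (U : Type) (M : structure L U) (a : list U) :
    term -> U -> Prop :=
| value_var i x : nth_error a i = Some x -> value M a (Tvar i) x
| value_app m ts xs y : Forall2 (value M a) ts xs -> fun_int M m xs y ->
    value M a (Tapp m ts) y.

Definition sat (L : language) (U : Type) (M : structure L U) (a : list U)
    (p : atomic) : Prop :=
  match p with
  | Arel n ts => exists xs, Forall2 (value M a) ts xs /\ rel_int M n xs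
  | Aeq s t => exists x, value M a s x /\ value M a t x
  end.

Definition simeq (L : language) (U V : Type) (A : structure L U) (a : list U)
    (B : structure L V) (b : list V) : Prop :=
  length a = length b /\
  forall p, wf_atomic L (length a) p -> (sat A a p <-> sat B b p).

Definition rel_set (L : language) (M : structure L nat) (x : nat) : Prop :=
  exists n a, x = pair_code n (list_code a) /\ rel_int M n a.

Definition nrel_set (L : language) (M : structure L nat) (x : nat) : Prop :=
  exists n a, x = pair_code n (list_code a) /\
    relsym L n /\ length a = arity L n /\ Forall (dom M) a /\ ~ rel_int M n a.

Definition fun_set (L : language) (M : structure L nat) (x : nat) : Prop :=
  exists m a b, x = pair_code m (pair_code (list_code a) b) /\ fun_int M m a b.

(* An index of a computable structure consists of an index deciding its
   underlying set and of c.e. indices of the diagrams. *)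
Definition structure_index (L : language) (e : nat) (M : structure L nat) :
    Prop :=
  exists e0 e1 e2 e3,
    e = pair_code e0 (pair_code e1 (pair_code e2 e3)) /\
    decides empty_set e0 (dom M) /\
    enumerates e1 (rel_set M) /\
    enumerates e2 (nrel_set M) /\
    enumerates e3 (fun_set M).

Definition structure_class (L : language) : Type :=
  forall U : Type, structure L U -> Prop.

Record age (L : language) : Type := {
  age_mem : structure_class L;
  age_fg : forall U (A : structure L U), age_mem A -> finitely_generated A;
  age_iso : forall U V (A : structure L U) (B : structure L V),
    isomorphic A B -> age_mem A -> age_mem B
}.

Definition triple_code (a : list nat) (e i : nat) : nat :=
  pair_code (list_code a) (pair_code e i).

(* The i-th triple is ([gens i], [index i], i), where [index i] is an index of
   the structure [str i].  A set with exactly one triple for each i is the graph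
   of such a family; [triples_ce] says that this set is c.e. *)
Record computable_age (L : language) (K : age L) : Type := {
  gens : nat -> list nat;
  index : nat -> nat;
  str : nat -> structure L nat;
  triples_ce : ce (fun x => exists i, x = triple_code (gens i) (index i) i);
  str_index : forall i, structure_index (index i) (str i);
  str_mem : forall i, age_mem K (str i);
  str_gens : forall i, generates (str i) (gens i);
  str_all : forall U (B : structure L U), age_mem K B ->
    exists i, isomorphic B (str i)
}.

Definition triple (L : language) (K : age L) (KK : computable_age K) (i : nat) :
    nat :=
  triple_code (gens KK i) (index KK i) i.

(* The embedding information. *)
Definition EI (L : language) (K : age L) (KK : computable_age K) (x : nat) :
    Prop :=
  exists k0 b0 k1 b1,
    x = pair_code (triple KK k0) (pair_code (list_code b0)
          (pair_code (triple KK k1) (list_code b1))) /\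
    Forall (dom (str KK k0)) b0 /\
    Forall (dom (str KK k1)) b1 /\
    simeq (str KK k0) b0 (str KK k1) b1.

Definition finite_language (L : language) : Prop :=
  exists l, forall n, relsym L n \/ funsym L n -> In n l.

Definition card_le (U : Type) (S : U -> Prop) (k : nat) : Prop :=
  exists l, NoDup l /\ (forall x, In x l <-> S x) /\ length l <= k.

Definition uniformly_finite (L : language) (K : structure_class L) : Prop :=
  finite_language L /\
  exists f, computable_fun f /\
    forall U (M : structure L U), K U M ->
    forall a, Forall (dom M) a -> card_le (cl M a) (f (length a)).

(* Main.v *)
(* Evaluating the same term on the tuples [a] of [A] and [b] of [B] yields a set
   [J] of pairs of values, inductively generated from the pairs [(a_i, b_i)] by the
   functions.  The tuples are equivalent iff [J] is a partial isomorphism.  As the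
   diagrams are uniformly c.e., so is [J], and a failure (two pairs breaking
   well-definedness or injectivity, or a relation holding on one side only) is a
   semidecidable event; hence the complement of the embedding information is c.e.,
   and 0' decides it.  If the language and the closures are finite, then
   equivalence is semidecidable as well: it is witnessed by a finite list of
   pairs that contains the [(a_i, b_i)], is closed under the functions, and is a
   partial isomorphism.  Inductive definitions with semidecidable rules are
   semidecidable because derivations are finite lists; this also yields the
   universal partial recursive function. *)

From Stdlib Require Import Arith List Lia Classical Cantor.
Import ListNotations.
Require Import Defs.

(** The indices of the two structures are part of the input, so everything has to be uniform in
    them; this is what forces a universal function rather than one program per structure. To keep
    explicit programs rare, a predicate is called semidecidable when it asks for a zero of a total
    recursive function, and closure properties come from composing such functions. Semidecidability
    is not preserved by negation, so each negative fact that occurs (outside the domain, a relation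
    failing, not being a triple, inequivalence) receives a positive description of its own.
    Equivalence is a universal statement about the possibly infinite set [J]; finite closures make
    [J] a finite list, and the statement becomes a single existential search. Post's theorem then
    combines this search with the one for the complement, which serves both halves of the
    theorem. *)

Definition pfst (x : nat) : nat := fst (Cantor.of_nat x).
Definition psnd (x : nat) : nat := snd (Cantor.of_nat x).

Lemma pfst_pair x y : pfst (pair_code x y) = x.
Proof. unfold pfst, pair_code; now rewrite Cantor.cancel_of_to. Qed.

Lemma psnd_pair x y : psnd (pair_code x y) = y.
Proof. unfold psnd, pair_code; now rewrite Cantor.cancel_of_to. Qed.

Lemma pair_eta x : pair_code (pfst x) (psnd x) = x.
Proof.
  unfold pfst, psnd, pair_code.
  now rewrite <- surjective_pairing, Cantor.cancel_to_of.
Qed.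

Lemma pair_code_le x y : x + y <= pair_code x y.
Proof. pose proof (Cantor.to_nat_non_decreasing x y). unfold pair_code; lia. Qed.

Lemma pfst_le x : pfst x <= x.
Proof. pose proof (pair_code_le (pfst x) (psnd x)). rewrite pair_eta in H; lia. Qed.

Lemma psnd_le x : psnd x <= x.
Proof. pose proof (pair_code_le (pfst x) (psnd x)). rewrite pair_eta in H; lia. Qed.

Ltac unpair := repeat rewrite ?pfst_pair, ?psnd_pair in *.

(** * Total recursive functions *)

(** One code must work for every oracle, so that it can be used both without an oracle and inside a
    reduction to [zero_jump]. *)
Definition recursive (f : nat -> nat) : Prop :=
  exists c, forall O x, eval O c x (f x).

Lemma recursive_ext f g : (forall x, f x = g x) -> recursive f -> recursive g.
Proof. intros E [c H]; exists c; intros O x; rewrite <- E; apply H. Qed.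

Lemma recursive_comp g f : recursive g -> recursive f -> recursive (fun x => g (f x)).
Proof. intros [c Hc] [d Hd]; exists (Ccomp c d); intros O x; simpl; eauto. Qed.

Lemma recursive_pair f g : recursive f -> recursive g ->
  recursive (fun x => pair_code (f x) (g x)).
Proof.
  intros [c Hc] [d Hd]; exists (Cpair c d); intros O x; simpl.
  exists (f x), (g x); auto.
Qed.

Lemma recursive_id : recursive (fun x => x).
Proof.
  exists (Cpair Cfst Csnd); intros O x; exists (pfst x), (psnd x).
  now rewrite pair_eta.
Qed.

Lemma recursive_succ f : recursive f -> recursive (fun x => S (f x)).
Proof. apply (recursive_comp S); now exists Csucc. Qed.

Lemma recursive_pfst f : recursive f -> recursive (fun x => pfst (f x)).
Proof. apply (recursive_comp pfst); now exists Cfst. Qed.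

Lemma recursive_psnd f : recursive f -> recursive (fun x => psnd (f x)).
Proof. apply (recursive_comp psnd); now exists Csnd. Qed.

Fixpoint const_code (n : nat) : code :=
  match n with
  | 0 => Czero
  | S n => Ccomp Csucc (const_code n)
  end.

Lemma eval_const_code O n x y : eval O (const_code n) x y <-> y = n.
Proof.
  revert y; induction n as [|n IH]; intros y; simpl; [easy|].
  split; [intros (u & Hu & ->); f_equal; now apply IH|].
  intros ->; exists n; split; [now apply IH | easy].
Qed.

Lemma recursive_const n : recursive (fun _ => n).
Proof. exists (const_code n); intros O x; now apply eval_const_code. Qed.

Lemma recursive_rec b s f g : recursive b -> recursive s ->
  recursive f -> recursive g ->
  recursive (fun x => nat_rect (fun _ => nat) (b (f x))
    (fun k w => s (pair_code (f x) (pair_code k w))) (g x)).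
Proof.
  intros [c Hc] [d Hd] Hf Hg.
  assert (H : recursive (fun z => nat_rect (fun _ => nat) (b (pfst z))
    (fun k w => s (pair_code (pfst z) (pair_code k w))) (psnd z))).
  { exists (Cprec c d); intros O z; simpl.
    change (fst (of_nat z)) with (pfst z); change (snd (of_nat z)) with (psnd z).
    induction (psnd z) as [|k IH]; simpl; [apply Hc|].
    eexists; split; [exact IH | apply Hd]. }
  apply recursive_ext with (2 := recursive_comp _ _ H (recursive_pair f g Hf Hg)).
  intros x; now unpair.
Qed.

Lemma recursive_iter h b f g : recursive h -> recursive b ->
  recursive f -> recursive g ->
  recursive (fun x => Nat.iter (g x) h (b (f x))).
Proof.
  intros Hh Hb Hf Hg.
  apply recursive_ext with (2 := recursive_rec b (fun z => h (psnd (psnd z))) f g Hb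
    (recursive_comp _ _ Hh (recursive_psnd _ (recursive_psnd _ recursive_id))) Hf Hg).
  intros x; induction (g x) as [|k IH]; simpl; [easy|]. unpair; now rewrite IH.
Qed.

Lemma recursive_add f g : recursive f -> recursive g -> recursive (fun x => f x + g x).
Proof.
  intros Hf Hg.
  apply recursive_ext with
    (2 := recursive_iter S (fun x => x) f g (recursive_succ _ recursive_id) recursive_id Hf Hg).
  intros x; induction (g x); simpl; lia.
Qed.

Lemma recursive_pred f : recursive f -> recursive (fun x => pred (f x)).
Proof.
  intros Hf.
  apply recursive_ext with (2 := recursive_rec (fun _ => 0) (fun z => pfst (psnd z)) f f
    (recursive_const 0) (recursive_pfst _ (recursive_psnd _ recursive_id)) Hf Hf).
  intros x; generalize (f x) at 1; intros n; destruct (f x); simpl; [easy|]; now unpair.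
Qed.

Lemma recursive_sub f g : recursive f -> recursive g -> recursive (fun x => f x - g x).
Proof.
  intros Hf Hg.
  apply recursive_ext with
    (2 := recursive_iter pred (fun x => x) f g (recursive_pred _ recursive_id) recursive_id Hf Hg).
  intros x; induction (g x); simpl; lia.
Qed.

(** With truth represented by the value 0, a bounded sum acts as a bounded universal quantifier, and
    a bounded product as a bounded existential one. *)
Lemma recursive_sum h b : recursive h -> recursive b ->
  recursive (fun x => nat_rect (fun _ => nat) 0
    (fun k w => w + h (pair_code x k)) (b x)).
Proof.
  intros Hh Hb.
  apply recursive_ext with (2 := recursive_rec (fun _ => 0)
    (fun z => psnd (psnd z) + h (pair_code (pfst z) (pfst (psnd z)))) (fun x => x) b
    (recursive_const 0) ltac:(auto 10 using recursive_add, recursive_comp,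
       recursive_pair, recursive_pfst, recursive_psnd, recursive_id)
    recursive_id Hb).
  intros x; induction (b x) as [|k IH]; simpl; [easy|]; unpair; now rewrite IH.
Qed.

Lemma recursive_mul f g : recursive f -> recursive g -> recursive (fun x => f x * g x).
Proof.
  intros Hf Hg.
  apply recursive_ext with (2 := recursive_sum (fun z => f (pfst z)) g
    (recursive_comp _ _ Hf (recursive_pfst _ recursive_id)) Hg).
  intros x; induction (g x) as [|k IH]; simpl; [lia|]; unpair; lia.
Qed.

Lemma recursive_prod h b : recursive h -> recursive b ->
  recursive (fun x => nat_rect (fun _ => nat) 1
    (fun k w => w * h (pair_code x k)) (b x)).
Proof.
  intros Hh Hb.
  apply recursive_ext with (2 := recursive_rec (fun _ => 1)
    (fun z => psnd (psnd z) * h (pair_code (pfst z) (pfst (psnd z)))) (fun x => x) b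
    (recursive_const 1) ltac:(auto 10 using recursive_mul, recursive_comp,
       recursive_pair, recursive_pfst, recursive_psnd, recursive_id)
    recursive_id Hb).
  intros x; induction (b x) as [|k IH]; simpl; [easy|]; unpair; now rewrite IH.
Qed.

(** On list codes this removes the first [k] entries: [pred] strips the successor of a nonempty
    code, [psnd] takes the tail, and the empty list 0 is a fixed point. It gives access to entries
    without a recursor on lists. *)
Definition drop (k n : nat) : nat := Nat.iter k (fun m => psnd (pred m)) n.

Lemma recursive_drop f g : recursive f -> recursive g ->
  recursive (fun x => drop (f x) (g x)).
Proof.
  intros Hf Hg; apply (recursive_iter (fun m => psnd (pred m)) (fun x => x));
    auto using recursive_id, recursive_pred, recursive_psnd.
Qed.

Ltac recursive_tac :=
  repeat first
    [ assumption | apply recursive_id | apply recursive_const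
    | apply recursive_pair | apply recursive_pfst | apply recursive_psnd
    | apply recursive_succ | apply recursive_pred
    | apply recursive_add | apply recursive_sub | apply recursive_mul
    | apply recursive_drop
    | match goal with
      | H : recursive ?g |- recursive (fun x => ?g (@?f x)) =>
          apply (recursive_comp g f H)
      end ].

(** * Semidecidable predicates *)

(** A Kleene normal form: [s] is a stage or witness, and the test at each stage is total. *)
Definition semidec (P : nat -> Prop) : Prop :=
  exists f, recursive f /\ forall x, P x <-> exists s, f (pair_code x s) = 0.

Lemma semidec_ext P Q : (forall x, P x <-> Q x) -> semidec P -> semidec Q.
Proof.
  intros E (f & Hf & H); exists f; split; [easy|]; intros x; now rewrite <- E.
Qed.

Lemma semidec_comp P f : semidec P -> recursive f -> semidec (fun x => P (f x)).
Proof.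
  intros (g & Hg & H) Hf.
  exists (fun z => g (pair_code (f (pfst z)) (psnd z))); split; [recursive_tac|].
  intros x; rewrite H; split; intros [s Hs]; exists s; now unpair.
Qed.

Lemma semidec_comp2 (P : nat -> nat -> Prop) f g :
  semidec (fun z => P (pfst z) (psnd z)) -> recursive f -> recursive g ->
  semidec (fun x => P (f x) (g x)).
Proof.
  intros HP Hf Hg.
  apply semidec_ext with (2 := semidec_comp _ _ HP (recursive_pair _ _ Hf Hg)).
  intros x; now unpair.
Qed.

Lemma semidec_comp3 (P : nat -> nat -> nat -> Prop) f g h :
  semidec (fun z => P (pfst z) (pfst (psnd z)) (psnd (psnd z))) ->
  recursive f -> recursive g -> recursive h ->
  semidec (fun x => P (f x) (g x) (h x)).
Proof.
  intros HP Hf Hg Hh.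
  apply semidec_ext with
    (2 := semidec_comp _ _ HP (recursive_pair _ _ Hf (recursive_pair _ _ Hg Hh))).
  intros x; now unpair.
Qed.

Lemma semidec_zero f : recursive f -> semidec (fun x => f x = 0).
Proof.
  intros Hf; exists (fun z => f (pfst z)); split; [recursive_tac|].
  intros x; split; [exists 0 | intros [s Hs]]; now unpair.
Qed.

Lemma semidec_eq f g : recursive f -> recursive g -> semidec (fun x => f x = g x).
Proof.
  intros Hf Hg; apply semidec_ext with (P := fun x => (f x - g x) + (g x - f x) = 0).
  - intros x; lia.
  - apply semidec_zero; recursive_tac.
Qed.

Lemma semidec_neq f g : recursive f -> recursive g -> semidec (fun x => f x <> g x).
Proof.
  intros Hf Hg; apply semidec_ext with (P := fun x => 1 - ((f x - g x) + (g x - f x)) = 0).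
  - intros x; lia.
  - apply semidec_zero; recursive_tac.
Qed.

Lemma semidec_and P Q : semidec P -> semidec Q -> semidec (fun x => P x /\ Q x).
Proof.
  intros (f & Hf & HP) (g & Hg & HQ).
  exists (fun z => f (pair_code (pfst z) (pfst (psnd z)))
                 + g (pair_code (pfst z) (psnd (psnd z)))).
  split; [recursive_tac|]; intros x; rewrite HP, HQ; split.
  - intros [[s Hs] [t Ht]]; exists (pair_code s t); unpair; lia.
  - intros [s Hs]; unpair; split; eexists; apply Nat.eq_add_0 in Hs; apply Hs.
Qed.

Lemma semidec_or P Q : semidec P -> semidec Q -> semidec (fun x => P x \/ Q x).
Proof.
  intros (f & Hf & HP) (g & Hg & HQ).
  exists (fun z => f z * g z).
  split; [recursive_tac|]; intros x; rewrite HP, HQ; split.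
  - intros [[s Hs]|[s Hs]]; exists s; rewrite Hs; lia.
  - intros [s Hs]; apply Nat.eq_mul_0 in Hs as [Hs|Hs]; eauto.
Qed.

Lemma semidec_ex (P : nat -> nat -> Prop) :
  semidec (fun z => P (pfst z) (psnd z)) -> semidec (fun x => exists y, P x y).
Proof.
  intros (f & Hf & HP).
  exists (fun z => f (pair_code (pair_code (pfst z) (pfst (psnd z))) (psnd (psnd z)))).
  split; [recursive_tac|]; intros x; split.
  - intros [y Hy]; specialize (HP (pair_code x y)); unpair.
    apply HP in Hy as [s Hs]; exists (pair_code y s); now unpair.
  - intros [s Hs]; unpair; exists (pfst s).
    specialize (HP (pair_code x (pfst s))); unpair; apply HP; eauto.
Qed.

Lemma sum_zero h n :
  nat_rect (fun _ => nat) 0 (fun k w => w + h k) n = 0 <->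
  forall k, k < n -> h k = 0.
Proof.
  induction n as [|n IH]; simpl; [split; [lia | easy]|].
  rewrite Nat.eq_add_0, IH; split.
  - intros [H1 H2] k Hk; destruct (Nat.eq_dec k n) as [->|]; [easy | apply H1; lia].
  - intros H; split; intros; apply H; lia.
Qed.

Lemma prod_zero h n :
  nat_rect (fun _ => nat) 1 (fun k w => w * h k) n = 0 <->
  exists k, k < n /\ h k = 0.
Proof.
  induction n as [|n IH]; simpl; [split; [lia | intros (k & Hk & _); lia]|].
  rewrite Nat.eq_mul_0, IH; split.
  - intros [(k & Hk & E)|E]; eauto.
  - intros (k & Hk & E); destruct (Nat.eq_dec k n) as [->|]; [now right|].
    left; exists k; split; [lia | easy].
Qed.

Lemma bounded_choice (P : nat -> nat -> Prop) n :
  (forall k, k < n -> exists s, P k s) ->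
  exists b, forall k, k < n -> exists s, s < b /\ P k s.
Proof.
  induction n as [|n IH]; intros H; [exists 0; lia|].
  destruct IH as [b Hb]; [intros; apply H; lia|].
  destruct (H n) as [s Hs]; [lia|].
  exists (b + S s); intros k Hk; destruct (Nat.eq_dec k n) as [->|].
  - exists s; split; [lia | easy].
  - destruct (Hb k) as (t & Ht & E); [lia|]; exists t; split; [lia | easy].
Qed.

Lemma semidec_all_lt (P : nat -> nat -> Prop) b : recursive b ->
  semidec (fun z => P (pfst z) (psnd z)) ->
  semidec (fun x => forall k, k < b x -> P x k).
Proof.
  intros Hb (f & Hf & HP).
  (* At stage [s], all [k < b x] must have a witness below the common bound [s]. *)
  exists (fun z => nat_rect (fun _ => nat) 0 (fun k w => w +
    (fun y => nat_rect (fun _ => nat) 1 (fun t w' => w' *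
      (fun u => f (pair_code (pair_code (pfst (pfst (pfst u))) (psnd (pfst u))) (psnd u)))
        (pair_code y t)) (psnd (pfst y))) (pair_code z k)) (b (pfst z))).
  split.
  - apply (recursive_sum (fun y => nat_rect (fun _ => nat) 1 (fun t w' => w' *
      (fun u => f (pair_code (pair_code (pfst (pfst (pfst u))) (psnd (pfst u))) (psnd u)))
        (pair_code y t)) (psnd (pfst y))) (fun z => b (pfst z))); [|recursive_tac].
    apply (recursive_prod (fun u => f (pair_code
      (pair_code (pfst (pfst (pfst u))) (psnd (pfst u))) (psnd u)))); recursive_tac.
  - intros x; split.
    + intros H.
      destruct (bounded_choice (fun k s => f (pair_code (pair_code x k) s) = 0) (b x))
        as [s Hs].
      { intros k Hk; specialize (HP (pair_code x k)); unpair; now apply HP, H. }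
      exists s; unpair; apply sum_zero; intros k Hk; unpair.
      apply (prod_zero (fun t => f (pair_code (pair_code (pfst (pfst (pfst (pair_code
        (pair_code (pair_code x s) k) t)))) (psnd (pfst (pair_code
        (pair_code (pair_code x s) k) t)))) (psnd (pair_code
        (pair_code (pair_code x s) k) t))))).
      destruct (Hs k Hk) as (t & Ht & E); exists t; unpair; easy.
    + intros [s Hs] k Hk.
      apply sum_zero with (k := k) in Hs; [|now unpair].
      apply (prod_zero (fun t => f (pair_code (pair_code (pfst (pfst (pfst (pair_code
        (pair_code (pair_code x s) k) t)))) (psnd (pfst (pair_code
        (pair_code (pair_code x s) k) t)))) (psnd (pair_code
        (pair_code (pair_code x s) k) t))))) in Hs as (t & _ & E).
      specialize (HP (pair_code x k)); unpair; apply HP; eauto.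
Qed.

Lemma semidec_const (C : Prop) : semidec (fun _ => C).
Proof.
  destruct (classic C) as [H|H].
  - apply semidec_ext with (P := fun x => x = x); [easy | apply semidec_eq; recursive_tac].
  - apply semidec_ext with (P := fun x => x <> x); [easy | apply semidec_neq; recursive_tac].
Qed.

(** The program is chosen by a classical case distinction, not effectively. This is harmless for a
    fixed [C], such as whether one given symbol is a relation symbol. *)
Lemma semidec_const_imp (C : Prop) P : semidec P -> semidec (fun x => C -> P x).
Proof.
  intros HP; destruct (classic C) as [H|H].
  - apply semidec_ext with (P := P); tauto.
  - apply semidec_ext with (P := fun _ => True); [tauto | apply semidec_const].
Qed.

(** The list is fixed outside the computation, so the [P n] may have unrelated programs; this suits
    the finitely many symbols of a finite language. *)
Lemma semidec_all_list {T : Type} (P : T -> nat -> Prop) (l : list T) :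
  (forall n, semidec (P n)) -> semidec (fun x => forall n, In n l -> P n x).
Proof.
  intros HP; induction l as [|m l IH].
  - apply semidec_ext with (P := fun _ => True); [easy | apply semidec_const].
  - apply semidec_ext with (2 := semidec_and _ _ (HP m) IH); intros x; simpl; split.
    + intros [H1 H2] n [<-|Hn]; auto.
    + intros H; split; auto.
Qed.

(** * Unbounded search, Post's theorem and the jump *)

Lemma least_zero h n : h n = 0 -> exists m, h m = 0 /\ forall k, k < m -> h k <> 0.
Proof.
  induction n as [n IH] using lt_wf_ind; intros Hn.
  destruct (classic (exists k, k < n /\ h k = 0)) as [(k & Hk & E)|N]; [eauto|].
  exists n; split; [easy|]; intros k Hk E; eauto.
Qed.

Lemma eval_functional O c x y z : eval O c x y -> eval O c x z -> y = z.
Proof.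
  revert x y z; induction c; intros x y z; simpl.
  1-4: congruence.
  - intuition congruence.
  - intros (u & v & H1 & H2 & ->) (u' & v' & H1' & H2' & ->); f_equal; eauto.
  - intros (u & H1 & H2) (u' & H1' & H2').
    assert (u = u') by eauto; subst; eauto.
  - revert y z; induction (snd (of_nat x)); simpl; intros y z; [eauto|].
    intros (u & H1 & H2) (u' & H1' & H2').
    assert (u = u') by eauto; subst; eauto.
  - intros [H1 H2] [H1' H2']; destruct (lt_eq_lt_dec y z) as [[H|H]|H]; auto.
    + destruct (H2' _ H) as [w Hw]; specialize (IHc _ _ _ H1 Hw); easy.
    + destruct (H2 _ H) as [w Hw]; specialize (IHc _ _ _ H1' Hw); easy.
Qed.

(** Totality of [f] keeps the search from getting stuck on a divergent value before it reaches a
    zero. *)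
Lemma mu_search f : recursive f -> exists c, forall O x,
  (forall y, eval O c x y -> f (pair_code x y) = 0) /\
  ((exists y, f (pair_code x y) = 0) -> exists y, eval O c x y).
Proof.
  intros [c Hc].
  exists (Cmu c); intros O x; split.
  - intros y [H _]; exact (eval_functional _ _ _ _ _ (Hc _ _) H).
  - intros [y Hy].
    destruct (least_zero (fun y => f (pair_code x y)) y Hy) as (m & Hm & Hl).
    exists m; split; [rewrite <- Hm; apply Hc|].
    intros k Hk; exists (pred (f (pair_code x k))).
    replace (S _) with (f (pair_code x k)); [apply Hc|].
    specialize (Hl k Hk); simpl in Hl; lia.
Qed.

(** Post's theorem. The product [f * g] vanishes at some stage because one of the two searches
    succeeds; at that stage [1 - f] is the characteristic value, since a nonzero [f] there means
    that [g] was the one to vanish. *)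
Lemma semidec_compl_computable S :
  semidec S -> semidec (fun x => ~ S x) -> computable S.
Proof.
  intros (f & Hf & HS) (g & Hg & HN).
  destruct (mu_search (fun z => f z * g z)) as [c Hc]; [recursive_tac|].
  destruct (recursive_sub (fun _ => 1) f (recursive_const 1) Hf) as [d Hd].
  destruct recursive_id as [i Hi].
  exists (code_num (Ccomp d (Cpair i c))); intros n.
  assert (E : exists s, f (pair_code n s) * g (pair_code n s) = 0 /\
     phi empty_set (code_num (Ccomp d (Cpair i c))) n (1 - f (pair_code n s))).
  { destruct (Hc empty_set n) as [H1 H2]; destruct H2 as [s Hs].
    - destruct (classic (S n)) as [H|H].
      + apply HS in H as [s Hs]; exists s; rewrite Hs; lia.
      + apply HN in H as [s Hs]; exists s; rewrite Hs; lia.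
    - exists s; split; [now apply H1|].
      eexists; split; [reflexivity|]; simpl; eexists; split.
      + exists n, s; auto.
      + apply Hd. }
  destruct E as (s & E & Hp); split; intros H.
  - replace (f (pair_code n s)) with 0 in Hp; [exact Hp|].
    apply Nat.eq_mul_0 in E as [E|E]; [easy|].
    exfalso; apply (HN n); eauto.
  - replace (1 - f (pair_code n s)) with 0 in Hp; [exact Hp|].
    assert (f (pair_code n s) <> 0); [intros E'; apply H, HS; eauto | lia].
Qed.

(** [Ccomp c (const_code x)] ignores its input and searches for a witness of [~ S x]. It therefore
    halts on its own number iff [~ S x], and one oracle query at that number decides [S x]. *)
Lemma semidec_compl_turing_le_zero_jump S :
  semidec (fun x => ~ S x) -> turing_le S zero_jump.
Proof.
  intros (f & Hf & HN); destruct (mu_search f Hf) as [c Hc].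
  assert (Hq : recursive (fun x => code_num (Ccomp c (const_code x)))).
  (* A concrete instance of the s-m-n theorem: [const_code x] stacks [x] compositions with [Csucc]
     on [Czero], where 6 is the offset of [Ccomp] in the numbering, 1 the number of [Csucc], and 0
     that of [Czero]. *)
  { assert (Hk : recursive (fun x => code_num (const_code x))).
    { apply recursive_ext with (2 := recursive_iter
        (fun w => 6 + 4 * pair_code 1 w) (fun x => x) (fun _ => 0) (fun x => x)
        ltac:(recursive_tac) recursive_id (recursive_const 0) recursive_id).
      intros x; induction x as [|x IH]; [reflexivity|].
      rewrite Nat.iter_succ, IH; reflexivity. }
    simpl code_num; recursive_tac. }
  destruct Hq as [q Hq].
  destruct (recursive_sub (fun _ => 1) (fun x => x) (recursive_const 1) recursive_id)
    as [d Hd].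
  assert (HJ : forall x, zero_jump (code_num (Ccomp c (const_code x))) <-> ~ S x).
  { intros x; rewrite HN; split.
    - intros (y & c' & Hn & Hy); apply code_num_inj in Hn; subst c'.
      destruct Hy as (u & Hu & Hy); apply eval_const_code in Hu; subst u.
      eexists; eapply Hc; eassumption.
    - intros H; apply (Hc empty_set) in H as [y Hy].
      exists y, (Ccomp c (const_code x)); split; [easy|].
      exists x; split; [now apply eval_const_code | easy]. }
  (* The oracle answers 1 exactly when [~ S n], so [d] flips the answer. *)
  exists (code_num (Ccomp d (Ccomp Coracle q))); intros n; split; intros H.
  - eexists; split; [reflexivity|]; exists 0; split; [|apply Hd].
    eexists; split; [apply Hq|]; right; split; [|easy]; now rewrite HJ; intros H'.
  - eexists; split; [reflexivity|]; exists 1; split; [|apply Hd].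
    eexists; split; [apply Hq|]; left; split; [|easy]; now apply HJ.
Qed.

(** * Coded lists *)

(** The number itself is enough fuel, since the tail of [S p] is [psnd p <= p]. Every number decodes
    to a list, so searching for a list is searching for a number, with no validity check. *)
Fixpoint dec_fuel (k n : nat) : list nat :=
  match k, n with
  | S k, S p => pfst p :: dec_fuel k (psnd p)
  | _, _ => []
  end.

Definition dec (n : nat) : list nat := dec_fuel n n.

Lemma list_code_dec_fuel k n : n <= k -> list_code (dec_fuel k n) = n.
Proof.
  revert n; induction k as [|k IH]; intros [|p] H; simpl; try lia.
  rewrite IH; [now rewrite pair_eta|]. pose proof (psnd_le p); lia.
Qed.

Lemma list_code_dec n : list_code (dec n) = n.
Proof. now apply list_code_dec_fuel. Qed.

Lemma list_code_inj l l' : list_code l = list_code l' -> l = l'.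
Proof.
  revert l'; induction l as [|x l IH]; intros [|x' l'] H; simpl in H; try easy.
  injection H as H; apply pair_code_inj in H as [-> H]; f_equal; auto.
Qed.

Lemma dec_list_code l : dec (list_code l) = l.
Proof. apply list_code_inj, list_code_dec. Qed.

Lemma dec_cons x l : dec (S (pair_code x l)) = x :: dec l.
Proof. apply list_code_inj; rewrite list_code_dec; simpl; now rewrite list_code_dec. Qed.

Lemma length_le_list_code l : length l <= list_code l.
Proof.
  induction l as [|x l IH]; simpl; [lia|].
  pose proof (pair_code_le x (list_code l)); lia.
Qed.

Lemma drop_list_code k l : drop k (list_code l) = list_code (skipn k l).
Proof.
  revert l; induction k as [|k IH]; intros l; [reflexivity|].
  unfold drop; rewrite Nat.iter_succ_r.
  destruct l as [|x l]; simpl pred.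
  - change (psnd 0) with (list_code []).
    fold (drop k (list_code [])); rewrite IH; now destruct k.
  - simpl; unpair; apply IH.
Qed.

Lemma nth_error_dec k n x :
  nth_error (dec n) k = Some x <-> exists r, drop k n = S (pair_code x r).
Proof.
  rewrite <- (list_code_dec n), dec_list_code; generalize (dec n); intros l.
  rewrite drop_list_code; revert l; induction k as [|k IH]; intros [|y l]; simpl.
  1, 3: split; [easy | intros [r Hr]; easy].
  - split.
    + intros [= ->]; eauto.
    + intros [r Hr]; injection Hr as Hr; now apply pair_code_inj in Hr as [-> _].
  - apply IH.
Qed.

Lemma semidec_nth_error f g h : recursive f -> recursive g -> recursive h ->
  semidec (fun x => nth_error (dec (f x)) (g x) = Some (h x)).
Proof.
  intros Hf Hg Hh.
  apply semidec_ext with (P := fun x => exists r, drop (g x) (f x) = S (pair_code (h x) r)).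
  - intros x; symmetry; apply nth_error_dec.
  - apply semidec_ex, semidec_eq; recursive_tac.
Qed.

Lemma semidec_In f g : recursive f -> recursive g ->
  semidec (fun x => In (f x) (dec (g x))).
Proof.
  intros Hf Hg.
  apply semidec_ext with (P := fun x => exists k, nth_error (dec (g x)) k = Some (f x)).
  - intros x; split; [intros [k Hk]; now apply nth_error_In in Hk | apply In_nth_error].
  - apply semidec_ex, semidec_nth_error; recursive_tac.
Qed.

(** Suffixes are used instead of entries because checking a derivation compares each entry with the
    tail behind it. The position [k] can be bounded by the code, which is at least the length;
    beyond the end [drop] returns 0. *)
Lemma semidec_all_suffix (P : nat -> nat -> nat -> Prop) g : recursive g ->
  semidec (fun z => P (pfst z) (pfst (psnd z)) (psnd (psnd z))) ->
  semidec (fun x => forall k y r, skipn k (dec (g x)) = y :: r -> P x y (list_code r)).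
Proof.
  intros Hg HP.
  apply semidec_ext with (P := fun x => forall k, k < g x ->
    drop k (g x) = 0 \/ exists y r, drop k (g x) = S (pair_code y r) /\ P x y r).
  - intros x; assert (E : forall k, drop k (g x) = list_code (skipn k (dec (g x)))).
    { intros k; now rewrite <- drop_list_code, list_code_dec. }
    split.
    + intros H k y r Hk.
      destruct (H k) as [H0|(y' & r' & H0 & HP')].
      * pose proof (length_le_list_code (dec (g x))) as Hl.
        rewrite list_code_dec in Hl.
        assert (length (skipn k (dec (g x))) > 0) by (rewrite Hk; simpl; lia).
        rewrite length_skipn in *; lia.
      * rewrite E, Hk in H0; easy.
      * rewrite E, Hk in H0; injection H0 as H0; apply pair_code_inj in H0 as [-> <-].
        easy.
    + intros H k _; rewrite E; specialize (H k).
      destruct (skipn k (dec (g x))) as [|y r]; [now left | right].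
      exists y, (list_code r); split; auto.
  - apply semidec_all_lt; [easy|].
    apply semidec_or; [apply semidec_eq; recursive_tac|].
    apply semidec_ex, semidec_ex, semidec_and; [apply semidec_eq; recursive_tac|].
    apply (semidec_comp3 P); recursive_tac.
Qed.

Lemma semidec_Forall (P : nat -> nat -> Prop) g : recursive g ->
  semidec (fun z => P (pfst z) (psnd z)) ->
  semidec (fun x => Forall (P x) (dec (g x))).
Proof.
  intros Hg HP.
  apply semidec_ext with (2 := semidec_all_suffix (fun x y _ => P x y) g Hg
    (semidec_comp2 P _ _ HP (recursive_pfst _ recursive_id)
       (recursive_pfst _ (recursive_psnd _ recursive_id)))).
  intros x; generalize (dec (g x)); intros l; split.
  - intros H; induction l as [|y l IH]; constructor; [now apply (H 0 y l)|].
    apply IH; intros k z r Hk; now apply (H (S k) z r).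
  - intros H k y r Hk; rewrite Forall_forall in H; apply H.
    rewrite <- (firstn_skipn k l), Hk; apply in_or_app; right; now left.
Qed.

Ltac semidec_tac :=
  cbv beta;
  repeat first
    [ assumption
    | solve [apply semidec_eq; recursive_tac]
    | solve [apply semidec_neq; recursive_tac]
    | solve [apply semidec_nth_error; recursive_tac]
    | solve [apply semidec_In; recursive_tac]
    | apply semidec_and | apply semidec_or | apply semidec_ex
    | apply semidec_Forall; [recursive_tac|]
    | apply semidec_all_lt; [recursive_tac|] ].

(** * Inductive definitions *)

(** [St x l] is an instance of a rule with conclusion [x], the number [l] coding the finite list of
    its premises. *)
Inductive derivable (St : nat -> nat -> Prop) (x : nat) : Prop :=
| derive l : St x l -> (forall z, In z (dec l) -> derivable St z) -> derivable St x.

Lemma derivable_list St x l :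
  St x (list_code l) -> (forall z, In z l -> derivable St z) -> derivable St x.
Proof. intros H; rewrite <- (dec_list_code l); now apply derive. Qed.

(** A proof tree flattened so that each entry is justified by entries further to the right. *)
Inductive derivation (St : nat -> nat -> Prop) : list nat -> Prop :=
| derivation_nil : derivation St []
| derivation_cons x l r : St x l -> incl (dec l) r -> derivation St r ->
    derivation St (x :: r).

Lemma derivation_app St l r : derivation St l -> derivation St r -> derivation St (l ++ r).
Proof.
  intros Hl Hr; induction Hl as [|x p l Hp Hi Hl IH]; simpl; [easy|].
  econstructor; eauto using incl_appl.
Qed.

Lemma derivation_derivable St d : derivation St d -> forall x, In x d -> derivable St x.
Proof.
  induction 1 as [|x l r Hl Hi Hr IH]; simpl; [easy|].
  intros y [<-|Hy]; [|auto]. econstructor; eauto.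
Qed.

Lemma derivable_derivation St x : derivable St x -> exists d, derivation St (x :: d).
Proof.
  induction 1 as [x l Hl H IH].
  (* Derivations of the premises are concatenated; each entry keeps its own premises to its
     right. *)
  assert (E : exists r, derivation St r /\ incl (dec l) r).
  { clear H Hl; induction (dec l) as [|y m IHm].
    - exists []; split; [constructor | easy].
    - destruct IHm as (r & Hr & Hi); [intros; apply IH; now right|].
      destruct (IH y) as [d Hd]; [now left|].
      exists ((y :: d) ++ r); split; [now apply derivation_app|].
      intros z [<-|Hz]; [now left|]; apply in_or_app; right; auto. }
  destruct E as (r & Hr & Hi); exists r; econstructor; eauto.
Qed.

(** This replaces the inductive predicate by a condition on suffixes, the form covered by
    [semidec_all_suffix]. *)
Lemma derivation_suffix St d : derivation St d <->
  forall k y r, skipn k d = y :: r ->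
    exists l, St y l /\ Forall (fun z => In z (dec (list_code r))) (dec l).
Proof.
  split.
  - induction 1 as [|x l r Hl Hi Hr IH]; intros [|k] y s; simpl; try easy.
    + intros [= -> ->]; exists l; split; [easy|].
      rewrite dec_list_code; now apply Forall_forall.
    + apply IH.
  - induction d as [|x d IH]; intros H; [constructor|].
    destruct (H 0 x d) as (l & Hl & Hi); [easy|].
    rewrite dec_list_code, Forall_forall in Hi.
    econstructor; [exact Hl | exact Hi|].
    apply IH; intros k y r Hk; now apply (H (S k)).
Qed.

Lemma semidec_derivable St :
  semidec (fun z => St (pfst z) (psnd z)) -> semidec (derivable St).
Proof.
  intros HS.
  apply semidec_ext with (P := fun x => exists d, In x (dec d) /\
    forall k y r, skipn k (dec d) = y :: r ->
      exists l, St y l /\ Forall (fun z => In z (dec (list_code r))) (dec l)).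
  - intros x; split.
    + intros (d & Hx & Hd); apply derivation_suffix in Hd.
      eapply derivation_derivable; eauto.
    + intros H; apply derivable_derivation in H as [d Hd].
      exists (list_code (x :: d)); rewrite dec_list_code; split; [now left|].
      now apply derivation_suffix.
  - apply semidec_ex, semidec_and; [semidec_tac|].
    apply (semidec_all_suffix (fun _ y r => exists l, St y l /\
      Forall (fun z => In z (dec r)) (dec l)) psnd).
    + recursive_tac.
    + apply semidec_ex, semidec_and.
      * apply (semidec_comp2 St); [easy | recursive_tac ..].
      * semidec_tac.
Qed.

(** * The universal function *)

(** The residue modulo 4 of the number minus 5 determines the compound constructor. Thus the bare
    numbers occurring in [phi_step] can always be read as programs. *)
Lemma code_num_surj e : exists c, code_num c = e.
Proof.
  induction e as [e IH] using lt_wf_ind.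
  destruct e as [|[|[|[|[|n]]]]].
  1: now exists Czero.
  1: now exists Csucc.
  1: now exists Cfst.
  1: now exists Csnd.
  1: now exists Coracle.
  assert (E : exists q, n = 4 * q \/ n = 1 + 4 * q \/ n = 2 + 4 * q \/ n = 3 + 4 * q).
  { exists (n / 4); pose proof (Nat.div_mod_eq n 4).
    pose proof (Nat.mod_upper_bound n 4); lia. }
  destruct E as [q Hq].
  pose proof (pfst_le q); pose proof (psnd_le q).
  destruct (IH (pfst q)) as [c Hc]; [lia|].
  destruct (IH (psnd q)) as [d Hd]; [lia|].
  destruct (IH q) as [b Hb]; [lia|].
  destruct Hq as [-> | [-> | [-> | ->]]].
  - exists (Cpair c d); simpl code_num; rewrite Hc, Hd, pair_eta; lia.
  - exists (Ccomp c d); simpl code_num; rewrite Hc, Hd, pair_eta; lia.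
  - exists (Cprec c d); simpl code_num; rewrite Hc, Hd, pair_eta; lia.
  - exists (Cmu b); simpl code_num; rewrite Hb; lia.
Qed.

Lemma phi_code_num O c x y : phi O (code_num c) x y <-> eval O c x y.
Proof.
  split; [intros (d & Hd & H); apply code_num_inj in Hd; now subst|].
  intros H; exists c; auto.
Qed.

(** A ternary judgement as one number, reused below for evaluation, parallel list traversal and
    joint values. *)
Definition fact (e x y : nat) : nat := pair_code e (pair_code x y).

(** The clauses of [eval] as rules, with the numerical tags of [code_num]. The oracle is empty, so
    program 4 always answers 0. The rule for [Cprec] makes one recursion step and calls the same [e]
    again. *)
Definition phi_step (t l : nat) : Prop :=
  exists e x y, t = fact e x y /\
  ((e = 0 /\ y = 0) \/ (e = 1 /\ y = S x) \/ (e = 2 /\ y = pfst x) \/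
   (e = 3 /\ y = psnd x) \/ (e = 4 /\ y = 0) \/
   (exists c d u v, e = 5 + 4 * pair_code c d /\ In (fact c x u) (dec l) /\
      In (fact d x v) (dec l) /\ y = pair_code u v) \/
   (exists c d u, e = 6 + 4 * pair_code c d /\ In (fact d x u) (dec l) /\
      In (fact c u y) (dec l)) \/
   (exists c d, e = 7 + 4 * pair_code c d /\
      ((psnd x = 0 /\ In (fact c (pfst x) y) (dec l)) \/
       exists k w, psnd x = S k /\ In (fact e (pair_code (pfst x) k) w) (dec l) /\
         In (fact d (pair_code (pfst x) (pair_code k w)) y) (dec l))) \/
   (exists c, e = 8 + 4 * c /\ In (fact c (pair_code x y) 0) (dec l) /\
      forall k, k < y -> exists z, In (fact c (pair_code x k) (S z)) (dec l))).

Lemma semidec_phi_step : semidec (fun z => phi_step (pfst z) (psnd z)).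
Proof. unfold phi_step, fact; semidec_tac. Qed.

(** This supplies the premises of the rule for [Cmu]: one value for each [k] below the output,
    stored together with [k]. The second conclusion says that nothing underivable is collected. *)
Lemma bounded_collect (P : nat -> nat -> Prop) n :
  (forall k, k < n -> exists z, P k z) ->
  exists l, (forall k, k < n -> exists z, P k z /\ In (pair_code k z) l) /\
    forall u, In u l -> P (pfst u) (psnd u).
Proof.
  induction n as [|n IH]; intros H; [exists []; split; [lia | easy]|].
  destruct IH as (l & H1 & H2); [intros; apply H; lia|].
  destruct (H n) as [z Hz]; [lia|].
  exists (pair_code n z :: l); split.
  - intros k Hk; destruct (Nat.eq_dec k n) as [->|]; [exists z; split; [easy | now left]|].
    destruct (H1 k) as (w & Hw & Hi); [lia|]; exists w; split; [easy | now right].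
  - intros u [<-|Hu]; [now unpair | auto].
Qed.

Lemma eval_prec O c d n k y : eval O (Cprec c d) (pair_code n k) y <->
  match k with
  | 0 => eval O c n y
  | S k => exists w, eval O (Cprec c d) (pair_code n k) w /\
      eval O d (pair_code n (pair_code k w)) y
  end.
Proof.
  unfold pair_code; cbn [eval]; destruct k as [|k];
    now rewrite ?Cantor.cancel_of_to.
Qed.

Lemma derivable_phi_step_eval t : derivable phi_step t -> forall c x y,
  t = fact (code_num c) x y -> eval empty_set c x y.
Proof.
  induction 1 as [t l (e & x & y & -> & Hs) _ IH]; intros c0 x0 y0 Ht.
  unfold fact in Ht; apply pair_code_inj in Ht as [-> Ht].
  apply pair_code_inj in Ht as [-> ->]; rename x0 into x, y0 into y.
  assert (IH' : forall c x y, In (fact (code_num c) x y) (dec l) -> eval empty_set c x y)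
    by eauto.
  clear IH.
  destruct Hs as [[He Hs]|[[He Hs]|[[He Hs]|[[He Hs]|[[He Hs]|[Hs|[Hs|[Hs|Hs]]]]]]]].
  1-5: destruct c0; simpl code_num in He; try lia; simpl; auto.
  - destruct Hs as (c & d & u & v & He & Hc & Hd & ->).
    destruct (code_num_surj c) as [c' <-], (code_num_surj d) as [d' <-].
    apply (@code_num_inj c0 (Cpair c' d')) in He as ->.
    exists u, v; auto.
  - destruct Hs as (c & d & u & He & Hd & Hc).
    destruct (code_num_surj c) as [c' <-], (code_num_surj d) as [d' <-].
    apply (@code_num_inj c0 (Ccomp c' d')) in He as ->.
    exists u; auto.
  - destruct Hs as (c & d & He & Hs).
    destruct (code_num_surj c) as [c' <-], (code_num_surj d) as [d' <-].
    apply (@code_num_inj c0 (Cprec c' d')) in He as ->.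
    rewrite <- (pair_eta x); apply eval_prec.
    destruct Hs as [[-> Hs]|(k & w & -> & Hk & Hd)]; [auto|].
    exists w; split; [now apply IH' in Hk | auto].
  - destruct Hs as (c & He & H0 & Hk).
    destruct (code_num_surj c) as [c' <-].
    apply (@code_num_inj c0 (Cmu c')) in He as ->.
    split; [auto|]; intros k Hlt; destruct (Hk k Hlt) as [z Hz]; eauto.
Qed.

Lemma eval_derivable_phi_step c x y :
  eval empty_set c x y -> derivable phi_step (fact (code_num c) x y).
Proof.
  revert x y; induction c as [| | | | | c IHc d IHd | c IHc d IHd | c IHc d IHd | c IHc];
    intros x y H.
  1-5: apply derivable_list with (l := []); [|easy];
    do 3 eexists; split; [reflexivity|]; simpl in *; tauto.
  - destruct H as (u & v & Hc & Hd & ->).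
    apply derivable_list with
      (l := [fact (code_num c) x u; fact (code_num d) x v]).
    + do 3 eexists; split; [reflexivity|]; do 5 right; left.
      rewrite dec_list_code; simpl.
      exists (code_num c), (code_num d), u, v; auto 10.
    + intros z [<-|[<-|[]]]; auto.
  - destruct H as (u & Hd & Hc).
    apply derivable_list with
      (l := [fact (code_num d) x u; fact (code_num c) u y]).
    + do 3 eexists; split; [reflexivity|]; do 6 right; left.
      rewrite dec_list_code; simpl.
      exists (code_num c), (code_num d), u; auto 10.
    + intros z [<-|[<-|[]]]; auto.
  (* Since the rule unfolds a single step, an inner induction on the counter [psnd x] is
     required. *)
  - rewrite <- (pair_eta x) in H |- *.
    revert y H; induction (psnd x) as [|k IH]; intros y H; apply eval_prec in H.
    + apply derivable_list with (l := [fact (code_num c) (pfst x) y]).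
      * do 3 eexists; split; [reflexivity|]; do 7 right; left.
        rewrite dec_list_code; simpl; unpair.
        exists (code_num c), (code_num d); auto 10.
      * intros z [<-|[]]; auto.
    + destruct H as (w & Hw & Hd).
      apply derivable_list with
        (l := [fact (code_num (Cprec c d)) (pair_code (pfst x) k) w;
               fact (code_num d) (pair_code (pfst x) (pair_code k w)) y]).
      * do 3 eexists; split; [reflexivity|]; do 7 right; left.
        rewrite dec_list_code; unpair.
        exists (code_num c), (code_num d); split; [reflexivity|]; right.
        exists k, w; simpl; auto.
      * intros z [<-|[<-|[]]]; auto.
  - destruct H as [H0 Hk].
    apply bounded_collect in Hk as (l & H1 & H2).
    apply derivable_list with (l := fact (code_num c) (pair_code x y) 0 ::
      map (fun u => fact (code_num c) (pair_code x (pfst u)) (S (psnd u))) l).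
    + do 3 eexists; split; [reflexivity|]; do 8 right.
      rewrite dec_list_code; exists (code_num c); split; [reflexivity|].
      split; [now left|]; intros k Hk.
      destruct (H1 k Hk) as (z & _ & Hz); exists z; right.
      apply in_map_iff; eexists; split; [|exact Hz]; cbv beta; now unpair.
    + intros z [<-|Hz]; [auto|].
      apply in_map_iff in Hz as (u & <- & Hu); auto.
Qed.

Lemma phi_derivable e x y : phi empty_set e x y <-> derivable phi_step (fact e x y).
Proof.
  destruct (code_num_surj e) as [c <-]; rewrite phi_code_num; split.
  - apply eval_derivable_phi_step.
  - intros H; now apply derivable_phi_step_eval with (1 := H).
Qed.

(** The index may itself be computed from [z]: this is the universal function. *)
Lemma semidec_phi e x y : recursive e -> recursive x -> recursive y ->
  semidec (fun z => phi empty_set (e z) (x z) (y z)).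
Proof.
  intros He Hx Hy.
  apply semidec_ext with (P := fun z => derivable phi_step (fact (e z) (x z) (y z))).
  - intros z; symmetry; apply phi_derivable.
  - apply (semidec_comp _ (fun z => fact (e z) (x z) (y z))).
    + apply semidec_derivable, semidec_phi_step.
    + unfold fact; recursive_tac.
Qed.

Lemma ce_semidec P : ce P -> semidec P.
Proof.
  intros [e He].
  apply semidec_ext with (P := fun x => exists m, phi empty_set e x m).
  - intros x; symmetry; apply He.
  - apply semidec_ex, semidec_phi; recursive_tac.
Qed.

(** The parallel traversal of two lists is an inductive definition whose facts carry the parameter
    [v] along; 0 and [S (pair_code x r)] are the codes of nil and cons. *)
Lemma semidec_Forall2 (P : nat -> nat -> nat -> Prop) f g : recursive f -> recursive g ->
  semidec (fun z => P (pfst z) (pfst (psnd z)) (psnd (psnd z))) ->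
  semidec (fun x => Forall2 (P x) (dec (f x)) (dec (g x))).
Proof.
  intros Hf Hg HP.
  set (St t l := exists v xs ys, t = fact v xs ys /\ ((xs = 0 /\ ys = 0) \/
    exists x r y s, xs = S (pair_code x r) /\ ys = S (pair_code y s) /\
      P v x y /\ In (fact v r s) (dec l))).
  apply semidec_ext with (P := fun x => derivable St (fact x (f x) (g x))).
  - intros v; generalize (g v) as ys, (f v) as xs; intros ys xs; split.
    + intros H; remember (fact v xs ys) as t eqn:Ht; revert v xs ys Ht.
      induction H as [t l (v' & xs' & ys' & -> & Hs) _ IH]; intros v xs ys Ht.
      unfold fact in Ht; apply pair_code_inj in Ht as [-> Ht].
      apply pair_code_inj in Ht as [-> ->].
      destruct Hs as [[-> ->]|(x & r & y & s & -> & -> & HPxy & Hin)]; [constructor|].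
      rewrite !dec_cons; constructor; eauto.
    + rewrite <- (list_code_dec xs) at 2; rewrite <- (list_code_dec ys) at 2.
      induction 1 as [|x y xs' ys' Hxy _ IH].
      * apply derivable_list with (l := []); [|easy].
        do 3 eexists; split; [reflexivity | now left].
      * apply derivable_list with (l := [fact v (list_code xs') (list_code ys')]).
        -- do 3 eexists; split; [reflexivity|]; right; rewrite dec_list_code.
           do 4 eexists; simpl; auto.
        -- now intros z [<-|[]].
  - apply (semidec_comp _ (fun x => fact x (f x) (g x))); [|unfold fact; recursive_tac].
    apply semidec_derivable; unfold St, fact; semidec_tac.
    apply (semidec_comp3 P); recursive_tac.
Qed.

(** Lengths differ iff some [k] is enough to exhaust one list but not the other. *)
Lemma semidec_length_neq f g : recursive f -> recursive g ->
  semidec (fun x => length (dec (f x)) <> length (dec (g x))).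
Proof.
  intros Hf Hg.
  assert (E : forall k n, drop k n = 0 <-> length (dec n) <= k).
  { intros k n; rewrite <- (list_code_dec n), dec_list_code, drop_list_code.
    rewrite skipn_all_iff; destruct (skipn k (dec n)); now split. }
  apply semidec_ext with (P := fun x => exists k,
    (drop k (f x) = 0 /\ drop k (g x) <> 0) \/ (drop k (g x) = 0 /\ drop k (f x) <> 0)).
  - intros x; split.
    + intros [k Hk]; rewrite !E in Hk; lia.
    + intros H; destruct (le_lt_dec (length (dec (f x))) (length (dec (g x)))).
      * exists (length (dec (f x))); rewrite !E; lia.
      * exists (length (dec (g x))); rewrite !E; lia.
  - semidec_tac.
Qed.

(** The length [k], later the arity of a symbol, is fixed outside the computation, so the quantifier
    unfolds into [k] nested [Forall]. *)
Lemma semidec_all_tuples (P : nat -> nat -> Prop) k g : recursive g ->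
  semidec (fun z => P (pfst z) (psnd z)) ->
  semidec (fun x => forall t, length t = k -> incl t (dec (g x)) -> P x (list_code t)).
Proof.
  revert P g; induction k as [|k IH]; intros P g Hg HP.
  - apply semidec_ext with (P := fun x => P x 0).
    + intros x; split; [now intros H [|] | intros H; now apply (H [])].
    + apply (semidec_comp2 P); recursive_tac.
  - apply semidec_ext with (P := fun x => Forall (fun z => forall t, length t = k ->
      incl t (dec (g x)) -> P x (S (pair_code z (list_code t)))) (dec (g x))).
    + intros x; rewrite Forall_forall; split.
      * intros H [|z t] Hl Hi; [easy|]; apply (H z); [apply Hi; now left | now injection Hl|].
        intros y Hy; apply Hi; now right.
      * intros H z Hz t <- Hi; apply (H (z :: t)); [easy|].
        intros y [<-|Hy]; auto.
    + apply semidec_Forall; [easy|].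
      (* The chosen first entry joins the parameter, and the induction hypothesis treats the rest of
         the tuple. *)
      apply (IH (fun u t => P (pfst u) (S (pair_code (psnd u) t)))); [recursive_tac|].
      apply (semidec_comp2 P); recursive_tac.
Qed.

(** * Terms evaluated jointly in two structures *)

Lemma term_nested_ind (P : term -> Prop) :
  (forall i, P (Tvar i)) ->
  (forall m ts, (forall t, In t ts -> P t) -> P (Tapp m ts)) ->
  forall t, P t.
Proof.
  intros Hv Ha; fix rec 1; intros [i|m ts]; [apply Hv|].
  apply Ha; induction ts as [|s ts IH]; [intros t []|].
  intros t [<-|Ht]; [apply rec | now apply IH].
Qed.

Lemma fun_int_functional {L U} (M : structure L U) m a x y :
  fun_int M m a x -> fun_int M m a y -> x = y.
Proof.
  intros Hx Hy; destruct (fun_int_dom Hx) as (Hm & Hl & Ha & _).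
  destruct (fun_int_total Hm Hl Ha) as (z & _ & Hz).
  now rewrite <- (Hz x Hx), <- (Hz y Hy).
Qed.

Lemma value_functional {L U} (M : structure L U) a t x y :
  value M a t x -> value M a t y -> x = y.
Proof.
  revert x y; induction t as [i|m ts IH] using term_nested_ind; intros x y Hx Hy.
  - inversion Hx; inversion Hy; congruence.
  - inversion Hx as [|? ? xs ? Hxs Hfx]; inversion Hy as [|? ? ys ? Hys Hfy]; subst.
    assert (xs = ys) as ->; [|eapply fun_int_functional; eauto].
    clear - IH Hxs Hys; revert ys Hys.
    induction Hxs as [|t x ts xs Hx _ IHxs]; intros ys Hys; inversion Hys; subst; [easy|].
    f_equal; [apply (IH t); simpl; auto | apply IHxs; [|easy]; intros; apply (IH t0); simpl; auto].
Qed.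

Lemma value_dom {L U} (M : structure L U) a t x :
  Forall (dom M) a -> value M a t x -> dom M x.
Proof.
  intros Ha Hx; inversion Hx as [i ? Hi|m ts xs ? Hxs Hf]; subst.
  - rewrite Forall_forall in Ha; apply Ha; eapply nth_error_In; eauto.
  - now apply fun_int_dom in Hf.
Qed.

Lemma value_cl {L U} (M : structure L U) a t x : value M a t x -> cl M a x.
Proof.
  intros Hx S HS Ha; revert x Hx.
  induction t as [i|m ts IH] using term_nested_ind; intros x Hx;
    inversion Hx as [? ? Hi|? ? xs ? Hxs Hf]; subst.
  - rewrite Forall_forall in Ha; apply Ha; eapply nth_error_In; eauto.
  - apply (proj2 HS) with (2 := Hf); clear Hf Hx.
    induction Hxs as [|t y ts xs Hy _ IHxs]; constructor.
    + apply (IH t); simpl; auto.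
    + apply IHxs; intros s Hs; apply IH; simpl; auto.
Qed.

(** Graphs of functions exist only for symbols applied at the right arity. Hence the terms behind
    joint values may be used in atomic formulas. *)
Lemma value_wf {L U} (M : structure L U) a t x :
  value M a t x -> wf_term L (length a) t.
Proof.
  revert x; induction t as [i|m ts IH] using term_nested_ind; intros x Hx;
    inversion Hx as [? ? Hi|? ? xs ? Hxs Hf]; subst.
  - constructor; apply nth_error_Some; congruence.
  - destruct (fun_int_dom Hf) as (Hm & Hl & _).
    constructor; [easy | rewrite <- Hl; eapply Forall2_length; eauto|].
    clear - IH Hxs; induction Hxs as [|t y ts xs Hy _ IHxs]; [easy|].
    intros s [<-|Hs]; [apply (IH t) with y; simpl; auto|].
    apply IHxs; [intros; eapply IH; simpl; eauto | easy].
Qed.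

Lemma wf_term_value {L U} (M : structure L U) a t :
  Forall (dom M) a -> wf_term L (length a) t -> exists x, value M a t x.
Proof.
  intros Ha; induction t as [i|m ts IH] using term_nested_ind; intros Hw;
    inversion Hw as [? Hi|? ? Hm Hl Hts]; subst.
  - apply nth_error_Some in Hi; destruct (nth_error a i) as [x|] eqn:E; [|easy].
    exists x; now constructor.
  - assert (E : exists xs, Forall2 (value M a) ts xs).
    { clear - IH Hts; induction ts as [|t ts IHts]; [now exists []|].
      destruct IHts as [xs Hxs]; [intros; apply IH; simpl; auto | intros; apply Hts; simpl; auto|].
      destruct (IH t) as [x Hx]; [now left | apply Hts; now left|].
      exists (x :: xs); now constructor. }
    destruct E as [xs Hxs].
    destruct (fun_int_total (s := M) (m := m) (a := xs)) as (y & Hy & _).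
    + easy.
    + rewrite <- Hl; symmetry; eapply Forall2_length; eauto.
    + clear - Ha Hxs; induction Hxs as [|t x ts xs Hx _ IH]; constructor; [|easy].
      exact (value_dom _ _ _ _ Ha Hx).
    + exists y; econstructor; eauto.
Qed.

(** The set [J], here defined through terms; [joint_value_app] and [joint_value_ind] recover its
    description without terms. *)
Definition joint_value {L U V} (A : structure L U) (a : list U)
    (B : structure L V) (b : list V) (x : U) (y : V) : Prop :=
  exists t, value A a t x /\ value B b t y.

Lemma joint_value_list {L U V} (A : structure L U) a (B : structure L V) b xs ys :
  Forall2 (joint_value A a B b) xs ys <->
  exists ts, Forall2 (value A a) ts xs /\ Forall2 (value B b) ts ys.
Proof.
  split.
  - induction 1 as [|x y xs ys (t & Hx & Hy) _ (ts & Hxs & Hys)].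
    + exists []; auto.
    + exists (t :: ts); auto.
  - intros (ts & Hxs & Hys); revert ys Hys.
    induction Hxs as [|t x ts xs Hx _ IH]; intros ys Hys; inversion Hys; subst; constructor.
    + exists t; auto.
    + auto.
Qed.

Lemma joint_value_app {L U V} (A : structure L U) a (B : structure L V) b m xs ys x y :
  Forall2 (joint_value A a B b) xs ys -> fun_int A m xs x -> fun_int B m ys y ->
  joint_value A a B b x y.
Proof.
  intros H Hx Hy; apply joint_value_list in H as (ts & Hxs & Hys).
  exists (Tapp m ts); split; econstructor; eauto.
Qed.

Lemma joint_value_ind {L U V} (A : structure L U) a (B : structure L V) b
    (R : U -> V -> Prop) :
  (forall i x y, nth_error a i = Some x -> nth_error b i = Some y -> R x y) ->
  (forall m xs ys x y, Forall2 R xs ys -> fun_int A m xs x -> fun_int B m ys y -> R x y) ->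
  forall x y, joint_value A a B b x y -> R x y.
Proof.
  intros Hv Ha x y [t Ht]; revert x y Ht.
  induction t as [i|m ts IH] using term_nested_ind; intros x y [Hx Hy].
  - inversion Hx; inversion Hy; eauto.
  - inversion Hx as [|? ? xs ? Hxs Hfx]; inversion Hy as [|? ? ys ? Hys Hfy]; subst.
    apply Ha with m xs ys; auto; clear - IH Hxs Hys; revert ys Hys.
    induction Hxs as [|t x ts xs Hx _ IHxs]; intros ys Hys; inversion Hys; subst; constructor.
    + apply (IH t); simpl; auto.
    + apply IHxs; [intros; apply (IH t0); simpl; auto | easy].
Qed.

Lemma joint_value_dom {L U V} (A : structure L U) a (B : structure L V) b x y :
  Forall (dom A) a -> Forall (dom B) b -> joint_value A a B b x y -> dom A x /\ dom B y.
Proof. intros Ha Hb (t & Hx & Hy); split; eapply value_dom; eauto. Qed.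

Lemma wf_terms_value {L U} (M : structure L U) a ts : Forall (dom M) a ->
  (forall t, In t ts -> wf_term L (length a) t) -> exists xs, Forall2 (value M a) ts xs.
Proof.
  intros Ha; induction ts as [|t ts IH]; intros H; [now exists []|].
  destruct IH as [xs Hxs]; [intros; apply H; now right|].
  destruct (wf_term_value M a t Ha) as [x Hx]; [apply H; now left|].
  exists (x :: xs); now constructor.
Qed.

Lemma value_list_functional {L U} (M : structure L U) a ts xs ys :
  Forall2 (value M a) ts xs -> Forall2 (value M a) ts ys -> xs = ys.
Proof.
  intros Hxs; revert ys; induction Hxs as [|t x ts xs Hx _ IH]; intros ys Hys;
    inversion Hys; subst; [easy|].
  f_equal; [eapply value_functional; eauto | auto].
Qed.

(** Two pairs of [J] come from terms [s] and [t], and the formula [s = t] yields well-definedness in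
    one direction and injectivity in the other. Conversely, a well-formed term has exactly one value
    on each side, so every atomic formula is a statement about pairs of [J]. *)
Lemma simeq_iff {L U V} (A : structure L U) a (B : structure L V) b :
  Forall (dom A) a -> Forall (dom B) b ->
  (simeq A a B b <-> length a = length b /\
    (forall x y x' y', joint_value A a B b x y -> joint_value A a B b x' y' ->
       (x = x' <-> y = y')) /\
    (forall n xs ys, relsym L n -> length xs = arity L n ->
       Forall2 (joint_value A a B b) xs ys -> (rel_int A n xs <-> rel_int B n ys))).
Proof.
  intros Ha Hb; split.
  - intros [Hl H]; split; [easy|]; split.
    + intros x y x' y' (s & Hx & Hy) (t & Hx' & Hy').
      assert (Hw : wf_atomic L (length a) (Aeq s t)) by (split; eapply value_wf; eauto).
      specialize (H _ Hw); simpl in H; split; intros <-.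
      * destruct (proj1 H) as (z & Hz & Hz'); [eauto|].
        rewrite (value_functional _ _ _ _ _ Hy Hz); eapply value_functional; eauto.
      * destruct (proj2 H) as (z & Hz & Hz'); [eauto|].
        rewrite (value_functional _ _ _ _ _ Hx Hz); eapply value_functional; eauto.
    + intros n xs ys Hn Hlen Hj; apply joint_value_list in Hj as (ts & Hxs & Hys).
      assert (Hw : wf_atomic L (length a) (Arel n ts)).
      { split; [easy|]; split; [rewrite <- Hlen; eapply Forall2_length; eauto|].
        clear - Hxs; induction Hxs; [easy|].
        intros t [<-|Ht]; [eapply value_wf; eauto | auto]. }
      specialize (H _ Hw); simpl in H; split; intros Hr.
      * destruct (proj1 H) as (zs & Hzs & Hz); [eauto|].
        now rewrite (value_list_functional _ _ _ _ _ Hys Hzs).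
      * destruct (proj2 H) as (zs & Hzs & Hz); [eauto|].
        now rewrite (value_list_functional _ _ _ _ _ Hxs Hzs).
  - intros (Hl & He & Hr); split; [easy|]; intros [n ts|s t] Hw; simpl in Hw.
    + destruct Hw as (Hn & Hlen & Hts).
      destruct (wf_terms_value A a ts Ha Hts) as [xs Hxs].
      destruct (wf_terms_value B b ts Hb) as [ys Hys]; [now rewrite <- Hl|].
      assert (E : rel_int A n xs <-> rel_int B n ys).
      { apply Hr; [easy | | apply joint_value_list; eauto].
        rewrite <- Hlen; symmetry; eapply Forall2_length; eauto. }
      simpl; split; intros (zs & Hzs & Hz).
      * exists ys; split; [easy|]; apply E.
        now rewrite (value_list_functional _ _ _ _ _ Hxs Hzs).
      * exists xs; split; [easy|]; apply E.
        now rewrite (value_list_functional _ _ _ _ _ Hys Hzs).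
    + destruct Hw as [Hs Ht].
      destruct (wf_term_value A a s Ha Hs) as [x Hx].
      destruct (wf_term_value A a t Ha Ht) as [x' Hx'].
      rewrite Hl in Hs, Ht.
      destruct (wf_term_value B b s Hb Hs) as [y Hy].
      destruct (wf_term_value B b t Hb Ht) as [y' Hy'].
      assert (E : x = x' <-> y = y') by (apply He; [exists s | exists t]; auto).
      simpl; split; intros (z & Hz & Hz').
      * exists y; split; [easy|]; replace y with y'; [easy|]; symmetry; apply E.
        rewrite (value_functional _ _ _ _ _ Hx Hz); eapply value_functional; eauto.
      * exists x; split; [easy|]; replace x with x'; [easy|]; symmetry; apply E.
        rewrite (value_functional _ _ _ _ _ Hy Hz); eapply value_functional; eauto.
Qed.

(** * Computable structures given by their indices *)

(** These predicates read a structure off its index [e], uniformly in [e]. Negative information has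
    its own versions [ndom_at] and [nrel_at], so that both signs are semidecidable. *)
Definition dom_at (e x : nat) : Prop := phi empty_set (pfst e) x 1.
Definition ndom_at (e x : nat) : Prop := phi empty_set (pfst e) x 0.
Definition rel_at (e n xs : nat) : Prop :=
  exists m, phi empty_set (pfst (psnd e)) (pair_code n xs) m.
Definition nrel_at (e n xs : nat) : Prop :=
  exists m, phi empty_set (pfst (psnd (psnd e))) (pair_code n xs) m.
Definition fun_at (e m xs y : nat) : Prop :=
  exists z, phi empty_set (psnd (psnd (psnd e))) (pair_code m (pair_code xs y)) z.

Lemma phi_functional O e x y z : phi O e x y -> phi O e x z -> y = z.
Proof.
  destruct (code_num_surj e) as [c <-]; rewrite !phi_code_num; apply eval_functional.
Qed.

Lemma decides_phi e S n : decides empty_set e S ->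
  (phi empty_set e n 1 <-> S n) /\ (phi empty_set e n 0 <-> ~ S n).
Proof.
  intros H; destruct (H n) as [H1 H0]; split; (split; [|auto]); intros Hp.
  - apply NNPP; intros N; discriminate (phi_functional _ _ _ _ _ Hp (H0 N)).
  - intros N; discriminate (phi_functional _ _ _ _ _ Hp (H1 N)).
Qed.

Section StructureIndex.
Context {L : language} (M : structure L nat) (e : nat) (He : structure_index e M).

Lemma dom_at_iff x : dom_at e x <-> dom M x.
Proof.
  destruct He as (e0 & e1 & e2 & e3 & -> & H & _); unfold dom_at; unpair.
  now apply decides_phi.
Qed.

Lemma ndom_at_iff x : ndom_at e x <-> ~ dom M x.
Proof.
  destruct He as (e0 & e1 & e2 & e3 & -> & H & _); unfold ndom_at; unpair.
  now apply decides_phi.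
Qed.

Lemma rel_at_iff n xs : rel_at e n xs <-> rel_int M n (dec xs).
Proof.
  destruct He as (e0 & e1 & e2 & e3 & -> & _ & H & _); unfold rel_at; unpair.
  rewrite <- (H (pair_code n xs)); split.
  - intros (n' & a & E & Hr); apply pair_code_inj in E as [-> ->].
    now rewrite dec_list_code.
  - intros Hr; exists n, (dec xs); now rewrite list_code_dec.
Qed.

Lemma nrel_at_iff n xs : nrel_at e n xs <->
  relsym L n /\ length (dec xs) = arity L n /\ Forall (dom M) (dec xs) /\
  ~ rel_int M n (dec xs).
Proof.
  destruct He as (e0 & e1 & e2 & e3 & -> & _ & _ & H & _); unfold nrel_at; unpair.
  rewrite <- (H (pair_code n xs)); split.
  - intros (n' & a & E & Hr); apply pair_code_inj in E as [-> ->].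
    now rewrite dec_list_code.
  - intros Hr; exists n, (dec xs); now rewrite list_code_dec.
Qed.

Lemma fun_at_iff m xs y : fun_at e m xs y <-> fun_int M m (dec xs) y.
Proof.
  destruct He as (e0 & e1 & e2 & e3 & -> & _ & _ & _ & H); unfold fun_at; unpair.
  rewrite <- (H (pair_code m (pair_code xs y))); split.
  - intros (m' & a & b & E & Hf); apply pair_code_inj in E as [-> E].
    apply pair_code_inj in E as [-> ->]; now rewrite dec_list_code.
  - intros Hr; exists m, (dec xs), y; now rewrite list_code_dec.
Qed.

End StructureIndex.

Ltac semidec_tac ::=
  cbv beta;
  repeat first
    [ assumption
    | solve [apply semidec_eq; recursive_tac]
    | solve [apply semidec_neq; recursive_tac]
    | solve [apply semidec_nth_error; recursive_tac]
    | solve [apply semidec_In; recursive_tac]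
    | solve [apply semidec_phi; recursive_tac]
    | solve [apply semidec_length_neq; recursive_tac]
    | apply semidec_and | apply semidec_or | apply semidec_ex
    | apply semidec_Forall; [recursive_tac |]
    | apply semidec_Forall2; [recursive_tac | recursive_tac |]
    | apply semidec_all_lt; [recursive_tac|] ].

(** * Equivalence and inequivalence of tuples as searches *)

Definition lidx (v : nat) : nat := pfst v.
Definition ltup (v : nat) : nat := pfst (psnd v).
Definition ridx (v : nat) : nat := pfst (psnd (psnd v)).
Definition rtup (v : nat) : nat := psnd (psnd (psnd v)).
Definition problem (e a e' b : nat) : nat :=
  pair_code e (pair_code a (pair_code e' b)).

Definition joint_step (t l : nat) : Prop :=
  exists v x y, t = fact v x y /\
  ((exists i, nth_error (dec (ltup v)) i = Some x /\
              nth_error (dec (rtup v)) i = Some y) \/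
   (exists m xs ys, fun_at (lidx v) m xs x /\ fun_at (ridx v) m ys y /\
      Forall2 (fun x y => In (fact v x y) (dec l)) (dec xs) (dec ys))).

Definition joint_at (v x y : nat) : Prop := derivable joint_step (fact v x y).

Lemma semidec_joint_at v f g : recursive v -> recursive f -> recursive g ->
  semidec (fun x => joint_at (v x) (f x) (g x)).
Proof.
  intros Hv Hf Hg; apply (semidec_comp _ (fun x => fact (v x) (f x) (g x)));
    [|unfold fact; recursive_tac].
  apply semidec_derivable; unfold joint_step, fact, fun_at, lidx, ltup, ridx, rtup.
  semidec_tac.
Qed.

(** The failures of the three clauses of [simeq_iff], each stated by positive evidence. *)
Definition nsimeq_at (v : nat) : Prop :=
  length (dec (ltup v)) <> length (dec (rtup v)) \/
  (exists x y x' y', (joint_at v x y /\ joint_at v x' y') /\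
     ((x = x' /\ y <> y') \/ (x <> x' /\ y = y'))) \/
  (exists n xs ys, Forall2 (joint_at v) (dec xs) (dec ys) /\
     ((rel_at (lidx v) n xs /\ nrel_at (ridx v) n ys) \/
      (nrel_at (lidx v) n xs /\ rel_at (ridx v) n ys))).

Lemma semidec_nsimeq_at f : recursive f -> semidec (fun x => nsimeq_at (f x)).
Proof.
  intros Hf; apply (semidec_comp nsimeq_at f); [|easy]; clear f Hf.
  unfold nsimeq_at, rel_at, nrel_at, lidx, ltup, ridx, rtup.
  semidec_tac; apply semidec_joint_at; recursive_tac.
Qed.

(** [t] codes a list of pairs. Its two projections are specified by [Forall2] and searched for,
    which avoids a recursive map on list codes. *)
Definition rel_agree_at (n v t : nat) : Prop :=
  exists xs ys, (Forall2 (fun z x => x = pfst z) (dec t) (dec xs) /\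
                 Forall2 (fun z y => y = psnd z) (dec t) (dec ys)) /\
    ((rel_at (lidx v) n xs /\ rel_at (ridx v) n ys) \/
     (nrel_at (lidx v) n xs /\ nrel_at (ridx v) n ys)).

Definition fun_agree_at (m v P t : nat) : Prop :=
  exists xs ys x y, (Forall2 (fun z x => x = pfst z) (dec t) (dec xs) /\
                     Forall2 (fun z y => y = psnd z) (dec t) (dec ys)) /\
    fun_at (lidx v) m xs x /\ fun_at (ridx v) m ys y /\ In (pair_code x y) (dec P).

(* [P] lists codes of the pairs of a finite partial isomorphism; [l] is meant to
   list the symbols of [L]. *)
Definition simeq_at (L : language) (l : list nat) (v : nat) : Prop :=
  exists P,
    Forall2 (fun x y => In (pair_code x y) (dec P)) (dec (ltup v)) (dec (rtup v)) /\
    Forall (fun z => Forall (fun z' => (pfst z = pfst z' /\ psnd z = psnd z') \/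
      (pfst z <> pfst z' /\ psnd z <> psnd z')) (dec P)) (dec P) /\
    (forall n, In n l -> relsym L n -> forall t, length t = arity L n ->
       incl t (dec P) -> rel_agree_at n v (list_code t)) /\
    (forall m, In m l -> funsym L m -> forall t, length t = arity L m ->
       incl t (dec P) -> fun_agree_at m v P (list_code t)).

Lemma semidec_simeq_at L l f : recursive f -> semidec (fun x => simeq_at L l (f x)).
Proof.
  intros Hf; apply (semidec_comp (simeq_at L l) f); [|easy]; clear f Hf.
  unfold simeq_at, ltup, rtup.
  apply semidec_ex; repeat apply semidec_and.
  - semidec_tac.
  - semidec_tac.
  - apply (semidec_all_list (fun n z => relsym L n -> forall t, length t = arity L n ->
       incl t (dec (psnd z)) -> rel_agree_at n (pfst z) (list_code t))).
    intros n; apply semidec_const_imp.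
    apply (semidec_all_tuples (fun z t => rel_agree_at n (pfst z) t)); [recursive_tac|].
    unfold rel_agree_at, rel_at, nrel_at, lidx, ridx; semidec_tac.
  - apply (semidec_all_list (fun m z => funsym L m -> forall t, length t = arity L m ->
       incl t (dec (psnd z)) -> fun_agree_at m (pfst z) (psnd z) (list_code t))).
    intros m; apply semidec_const_imp.
    apply (semidec_all_tuples (fun z t => fun_agree_at m (pfst z) (psnd z) t));
      [recursive_tac|].
    unfold fun_agree_at, fun_at, lidx, ridx; semidec_tac.
Qed.

(** [Q] need not be decidable. A classical existence proof suffices, because the list only has to be
    present for an unbounded search to find it. *)
Lemma list_enumeration {T} (l : list T) (Q : T -> Prop) :
  (forall x, Q x -> In x l) -> exists l', forall x, In x l' <-> Q x.
Proof.
  revert Q; induction l as [|y l IH]; intros Q HQ.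
  - exists []; intros x; split; [easy | apply HQ].
  - destruct (IH (fun x => Q x /\ x <> y)) as [l' Hl'].
    { intros x [Hx Hn]; destruct (HQ x Hx); [congruence | easy]. }
    destruct (classic (Q y)) as [Hy|Hy].
    + exists (y :: l'); intros x; simpl; rewrite Hl'; split.
      * now intros [<-|[Hx _]].
      * intros Hx; destruct (classic (x = y)); auto.
    + exists l'; intros x; rewrite Hl'; split; [tauto|].
      intros Hx; split; [easy | now intros ->].
Qed.

Lemma Forall2_graph_map {T U} (f : T -> U) l l' :
  Forall2 (fun z x => x = f z) l l' <-> l' = map f l.
Proof.
  split.
  - induction 1 as [|z x l l' -> _ ->]; easy.
  - intros ->; induction l; simpl; auto.
Qed.

(** * Correctness of the searches for two given structures *)

Section Problem.
Context {L : language} (A B : structure L nat) (e e' : nat).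
Context (He : structure_index e A) (He' : structure_index e' B).
Context (a b : nat) (Ha : Forall (dom A) (dec a)) (Hb : Forall (dom B) (dec b)).

Local Notation v := (problem e a e' b).
Local Notation joint := (joint_value A (dec a) B (dec b)).

Lemma lidx_problem : lidx v = e.
Proof. unfold lidx, problem; now unpair. Qed.
Lemma ltup_problem : ltup v = a.
Proof. unfold ltup, problem; now unpair. Qed.
Lemma ridx_problem : ridx v = e'.
Proof. unfold ridx, problem; now unpair. Qed.
Lemma rtup_problem : rtup v = b.
Proof. unfold rtup, problem; now unpair. Qed.

Ltac unproblem :=
  rewrite ?lidx_problem, ?ltup_problem, ?ridx_problem, ?rtup_problem in *.

Lemma joint_at_iff x y : joint_at v x y <-> joint x y.
Proof.
  split.
  - unfold joint_at; intros H; remember (fact v x y) as t eqn:Ht; revert x y Ht.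
    induction H as [t l (w & x' & y' & -> & Hs) _ IH]; intros x y Ht.
    unfold fact in Ht; apply pair_code_inj in Ht as [-> Ht].
    apply pair_code_inj in Ht as [-> ->]; unproblem.
    destruct Hs as [(i & Hx & Hy)|(m & xs & ys & Hx & Hy & Hl)].
    + exists (Tvar i); split; now constructor.
    + apply (fun_at_iff A e He) in Hx; apply (fun_at_iff B e' He') in Hy.
      apply joint_value_app with (2 := Hx) (3 := Hy).
      eapply Forall2_impl; [|exact Hl]; simpl; eauto.
  - revert x y; apply joint_value_ind.
    + intros i x y Hx Hy; apply derivable_list with (l := []); [|easy].
      do 3 eexists; split; [reflexivity|]; left; exists i; now unproblem.
    + intros m xs ys x y Hj Hx Hy.
      apply derivable_list with
        (l := map (fun z => fact v (fst z) (snd z)) (combine xs ys)).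
      * do 3 eexists; split; [reflexivity|]; right.
        exists m, (list_code xs), (list_code ys); unproblem.
        rewrite (fun_at_iff A e He), (fun_at_iff B e' He'), !dec_list_code.
        do 2 (split; [easy|]); clear - Hj.
        induction Hj as [|x y xs ys _ _ IH]; simpl; constructor; [now left|].
        eapply Forall2_impl; [|exact IH]; simpl; auto.
      * intros z Hz; apply in_map_iff in Hz as ([x' y'] & <- & Hz); simpl.
        clear - Hj Hz; induction Hj as [|x y xs ys Hxy _ IH]; [easy|].
        destruct Hz as [[= <- <-]|Hz]; auto.
Qed.

Lemma joint_at_list_iff xs ys :
  Forall2 (joint_at v) xs ys <-> Forall2 joint xs ys.
Proof.
  split; apply Forall2_impl; intros x y; apply joint_at_iff.
Qed.

Lemma nsimeq_at_iff : nsimeq_at v <-> ~ simeq A (dec a) B (dec b).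
Proof.
  rewrite simeq_iff by easy; unfold nsimeq_at; unproblem; split.
  - intros H (Hl & He1 & Hr); destruct H as [H|[H|H]]; [easy | |].
    + destruct H as (x & y & x' & y' & [H H'] & Hn).
      apply joint_at_iff in H, H'; specialize (He1 _ _ _ _ H H'); lia.
    + destruct H as (n & xs & ys & Hj & Hn); apply joint_at_list_iff in Hj.
      rewrite !(rel_at_iff _ _ He), !(rel_at_iff _ _ He'),
        !(nrel_at_iff _ _ He), !(nrel_at_iff _ _ He') in Hn.
      destruct Hn as [[H1 (Hs & Hlen & _ & H2)]|[(Hs & Hlen & _ & H2) H1]];
        apply H2, (Hr n (dec xs) (dec ys)); auto.
      pose proof (Forall2_length Hj); congruence.
  - intros H; apply NNPP; intros N; apply H; split; [|split].
    + apply NNPP; intros Hl; apply N; now left.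
    + intros x y x' y' Hj Hj'; apply joint_at_iff in Hj, Hj'.
      apply NNPP; intros Hn; apply N; right; left.
      exists x, y, x', y'; split; [easy | lia].
    + intros n xs ys Hn Hl Hj.
      (* [nrel_at] also asserts membership in the domain, so the mere failure of a relation is not
         yet evidence for it. *)
      assert (HA : Forall (dom A) xs /\ Forall (dom B) ys).
      { clear Hl; induction Hj as [|x y xs ys Hxy _ IH]; [now split|].
        destruct (joint_value_dom _ _ _ _ _ _ Ha Hb Hxy); split; constructor; tauto. }
      apply joint_at_list_iff in Hj.
      apply NNPP; intros Hr; apply N; right; right.
      exists n, (list_code xs), (list_code ys).
      rewrite (rel_at_iff _ _ He), (rel_at_iff _ _ He'),
        (nrel_at_iff _ _ He), (nrel_at_iff _ _ He'), !dec_list_code.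
      assert (length ys = arity L n) by (pose proof (Forall2_length Hj); congruence).
      split; [easy|]; destruct (classic (rel_int A n xs)); tauto.
Qed.

(** [P] may be larger than [J]. It contains the initial pairs and is closed under the functions,
    hence includes [J] by induction, and [J] inherits the properties of a partial isomorphism. *)
Lemma simeq_at_sound l : (forall n, relsym L n \/ funsym L n -> In n l) ->
  simeq_at L l v -> simeq A (dec a) B (dec b).
Proof.
  intros Hl (P & H0 & Hinj & Hrel & Hfun); unproblem.
  assert (HP : forall x y, joint x y -> In (pair_code x y) (dec P)).
  { apply joint_value_ind.
    - revert H0; generalize (dec a), (dec b); clear.
      induction 1 as [|x y xs ys Hxy _ IH]; intros [|i] x' y'; simpl; try easy.
      + now intros [= <-] [= <-].
      + apply IH.
    - intros m xs ys x y Hj Hx Hy.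
      destruct (fun_int_dom Hx) as (Hm & Hlen & _).
      destruct (Hfun m ltac:(auto) Hm (map (fun z => pair_code (fst z) (snd z))
        (combine xs ys))) as (xs' & ys' & x' & y' & [Hxs Hys] & Hx' & Hy' & Hin).
      + rewrite length_map, length_combine, <- (Forall2_length Hj); lia.
      + intros z Hz; apply in_map_iff in Hz as ([x' y'] & <- & Hz); simpl.
        clear - Hj Hz; induction Hj as [|x y xs ys Hxy _ IH]; [easy|].
        destruct Hz as [[= <- <-]|Hz]; auto.
      + rewrite dec_list_code in *; unproblem.
        apply Forall2_graph_map in Hxs, Hys.
        apply (fun_at_iff _ _ He) in Hx'; apply (fun_at_iff _ _ He') in Hy'.
        (* The two projections of [combine xs ys] give back [xs] and [ys], since [Forall2] makes the
           lengths equal. *)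
        assert (E : dec xs' = xs /\ dec ys' = ys).
        { rewrite Hxs, Hys, !map_map; clear - Hj.
          induction Hj as [|u w us ws _ _ [IH1 IH2]]; [easy|].
          simpl; unpair; split; now f_equal. }
        destruct E as [E E']; rewrite E in Hx'; rewrite E' in Hy'.
        now rewrite (fun_int_functional _ _ _ _ _ Hx Hx'),
          (fun_int_functional _ _ _ _ _ Hy Hy'). }
  apply simeq_iff; [easy..|]; split; [now apply Forall2_length in H0|]; split.
  - intros x y x' y' Hj Hj'; apply HP in Hj, Hj'.
    rewrite Forall_forall in Hinj; apply Hinj in Hj.
    rewrite Forall_forall in Hj; apply Hj in Hj'; unpair; lia.
  - intros n xs ys Hn Hlen Hj.
    destruct (Hrel n ltac:(auto) Hn (map (fun z => pair_code (fst z) (snd z))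
      (combine xs ys))) as (xs' & ys' & [Hxs Hys] & Hr).
    + rewrite length_map, length_combine, <- (Forall2_length Hj); lia.
    + intros z Hz; apply in_map_iff in Hz as ([x' y'] & <- & Hz); simpl.
      clear - HP Hj Hz; induction Hj as [|x y xs ys Hxy _ IH]; [easy|].
      destruct Hz as [[= <- <-]|Hz]; auto.
    + rewrite dec_list_code in *; unproblem.
      apply Forall2_graph_map in Hxs, Hys.
      rewrite !(rel_at_iff _ _ He), !(rel_at_iff _ _ He'),
        !(nrel_at_iff _ _ He), !(nrel_at_iff _ _ He') in Hr.
      assert (E : dec xs' = xs /\ dec ys' = ys).
      { rewrite Hxs, Hys, !map_map; clear - Hj.
        induction Hj as [|u w us ws _ _ [IH1 IH2]]; [easy|].
        simpl; unpair; split; now f_equal. }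
      rewrite (proj1 E), (proj2 E) in Hr; tauto.
Qed.

(** The witness is [J] itself, which is finite as a subset of the product of the two closures. *)
Lemma simeq_at_complete l k k' :
  card_le (cl A (dec a)) k -> card_le (cl B (dec b)) k' ->
  simeq A (dec a) B (dec b) -> simeq_at L l v.
Proof.
  intros (la & _ & Hla & _) (lb & _ & Hlb & _) Hs.
  apply simeq_iff in Hs as (Hlen & Hinj & Hrel); [|easy..].
  destruct (list_enumeration (map (fun z => pair_code (fst z) (snd z)) (list_prod la lb))
    (fun z => joint (pfst z) (psnd z))) as [P HP].
  { intros z (t & Hx & Hy); apply in_map_iff.
    exists (pfst z, psnd z); simpl; split; [apply pair_eta|].
    apply in_prod; [apply Hla | apply Hlb]; eapply value_cl; eauto. }
  (* A tuple of pairs from [P] is a pair of argument tuples related entrywise by [J]; this gives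
     agreement of relations and closure under functions. *)
  assert (Hsplit : forall t, incl t P -> Forall2 joint (map pfst t) (map psnd t)).
  { induction t as [|z t IH]; intros Ht; simpl; constructor.
    - apply HP, Ht; now left.
    - apply IH; intros y Hy; apply Ht; now right. }
  assert (Hdom : forall t, incl t P ->
    Forall (dom A) (map pfst t) /\ Forall (dom B) (map psnd t)).
  { intros t Ht; rewrite !Forall_map, !Forall_forall; split; intros z Hz;
      apply Ht, HP in Hz; apply (joint_value_dom _ _ _ _ _ _ Ha Hb Hz). }
  exists (list_code P); rewrite dec_list_code; split; [|split; [|split]]; unproblem.
  - assert (Hin : forall i x y, nth_error (dec a) i = Some x ->
      nth_error (dec b) i = Some y -> In (pair_code x y) P).
    { intros i x y Hx Hy; apply HP; unpair.
      exists (Tvar i); split; now constructor. }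
    clear - Hin Hlen; revert Hlen Hin; generalize (dec b) as ys, (dec a) as xs.
    intros ys xs; revert ys; induction xs as [|x xs IH]; intros [|y ys] Hl Hin;
      try easy; constructor.
    + now apply (Hin 0).
    + apply IH; [now injection Hl | intros i; apply (Hin (S i))].
  - rewrite Forall_forall; intros z Hz; rewrite Forall_forall; intros z' Hz'.
    apply HP in Hz, Hz'; specialize (Hinj _ _ _ _ Hz Hz'); lia.
  - intros n _ Hn t Ht Hi.
    exists (list_code (map pfst t)), (list_code (map psnd t)).
    rewrite !dec_list_code, !Forall2_graph_map; split; [easy|]; unproblem.
    rewrite (rel_at_iff _ _ He), (rel_at_iff _ _ He'),
      (nrel_at_iff _ _ He), (nrel_at_iff _ _ He'), !dec_list_code, !length_map.
    assert (Hr := Hrel n _ _ Hn (eq_trans (length_map _ _) Ht) (Hsplit t Hi)).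
    destruct (Hdom t Hi); destruct (classic (rel_int A n (map pfst t))); tauto.
  - intros m _ Hm t Ht Hi; destruct (Hdom t Hi) as [HA HB].
    destruct (fun_int_total Hm (eq_trans (length_map pfst t) Ht) HA) as (x & Hx & _).
    destruct (fun_int_total Hm (eq_trans (length_map psnd t) Ht) HB) as (y & Hy & _).
    exists (list_code (map pfst t)), (list_code (map psnd t)), x, y; unproblem.
    rewrite (fun_at_iff _ _ He), (fun_at_iff _ _ He').
    rewrite !dec_list_code, !Forall2_graph_map; repeat split; auto.
    apply HP; unpair.
    exact (joint_value_app _ _ _ _ _ _ _ _ _ (Hsplit t Hi) Hx Hy).
Qed.

End Problem.

(** * Embedding information *)

Definition triple_index (t : nat) : nat := pfst (psnd t).
Definition triple_no (t : nat) : nat := psnd (psnd t).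
Definition ltriple (x : nat) : nat := pfst x.
Definition llist (x : nat) : nat := pfst (psnd x).
Definition rtriple (x : nat) : nat := pfst (psnd (psnd x)).
Definition rlist (x : nat) : nat := psnd (psnd (psnd x)).

Definition EI_problem (x : nat) : nat :=
  problem (triple_index (ltriple x)) (llist x) (triple_index (rtriple x)) (rlist x).

Section EmbeddingInformation.
Context {L : language} {K : age L} (KK : computable_age K).

Definition is_triple (t : nat) : Prop := exists i, t = triple KK i.
(** Each number belongs to exactly one triple, so a non-triple is exposed by enumerating the true
    triple with the same last component. *)
Definition not_triple (t : nat) : Prop :=
  exists t', is_triple t' /\ triple_no t' = triple_no t /\ t' <> t.

Lemma triple_no_triple i : triple_no (triple KK i) = i.
Proof. unfold triple_no, triple, triple_code; now unpair. Qed.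

Lemma triple_index_triple i : triple_index (triple KK i) = index KK i.
Proof. unfold triple_index, triple, triple_code; now unpair. Qed.

Lemma not_triple_iff t : not_triple t <-> ~ is_triple t.
Proof.
  split.
  - intros (t' & [i ->] & E & Hn) [j ->]; rewrite !triple_no_triple in E; congruence.
  - intros H; exists (triple KK (triple_no t)); rewrite triple_no_triple.
    repeat split; [now exists (triple_no t)|].
    intros E; apply H; now exists (triple_no t).
Qed.

Lemma semidec_is_triple f : recursive f -> semidec (fun x => is_triple (f x)).
Proof.
  apply (semidec_comp is_triple), ce_semidec, (triples_ce KK).
Qed.

Lemma semidec_not_triple f : recursive f -> semidec (fun x => not_triple (f x)).
Proof.
  intros Hf; apply (semidec_comp not_triple f); [|easy].
  apply semidec_ex, semidec_and; [apply semidec_is_triple; recursive_tac|].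
  unfold triple_no; semidec_tac.
Qed.

Lemma EI_iff x : EI KK x <-> exists k k',
  ltriple x = triple KK k /\ rtriple x = triple KK k' /\
  Forall (dom (str KK k)) (dec (llist x)) /\
  Forall (dom (str KK k')) (dec (rlist x)) /\
  simeq (str KK k) (dec (llist x)) (str KK k') (dec (rlist x)).
Proof.
  unfold ltriple, rtriple, llist, rlist; split.
  - intros (k & b & k' & b' & -> & H); exists k, k'; unpair.
    now rewrite !dec_list_code.
  - intros (k & k' & E & E' & H).
    exists k, (dec (pfst (psnd x))), k', (dec (psnd (psnd (psnd x)))).
    rewrite !list_code_dec, <- E, <- E', !pair_eta; auto.
Qed.

(** A number also fails when a component is no triple or a tuple leaves its domain. [nsimeq_at] is
    meaningful only for indices of structures, hence the guard that both components are triples. *)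
Lemma semidec_compl_EI : semidec (fun x => ~ EI KK x).
Proof.
  apply semidec_ext with (P := fun x => not_triple (ltriple x) \/ not_triple (rtriple x) \/
    (is_triple (ltriple x) /\ is_triple (rtriple x) /\
      ((exists z, In z (dec (llist x)) /\ ndom_at (triple_index (ltriple x)) z) \/
       (exists z, In z (dec (rlist x)) /\ ndom_at (triple_index (rtriple x)) z) \/
       nsimeq_at (EI_problem x)))).
  - intros x; rewrite !not_triple_iff, EI_iff; split.
    + intros H (k & k' & E & E' & Hd & Hd' & Hs).
      unfold EI_problem in H; rewrite E, E', !triple_index_triple in H.
      assert (T : forall i, is_triple (triple KK i)) by (intros i; now exists i).
      destruct H as [H|[H|(_ & _ & [(z & Hz & Hn)|[(z & Hz & Hn)|H]])]].
      * now apply H.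
      * now apply H.
      * apply (ndom_at_iff _ _ (str_index KK k)) in Hn; rewrite Forall_forall in Hd; auto.
      * apply (ndom_at_iff _ _ (str_index KK k')) in Hn; rewrite Forall_forall in Hd'; auto.
      * apply nsimeq_at_iff with (A := str KK k) (B := str KK k') in H;
          auto using str_index.
    + intros H; destruct (classic (is_triple (ltriple x))) as [[k E]|]; [|now left].
      destruct (classic (is_triple (rtriple x))) as [[k' E']|]; [|now right; left].
      right; right; unfold EI_problem; rewrite E, E', !triple_index_triple.
      do 2 (split; [eexists; reflexivity|]); apply NNPP; intros N; apply H.
      assert (Hd : Forall (dom (str KK k)) (dec (llist x))).
      { apply Forall_forall; intros z Hz; apply NNPP; intros Hn; apply N; left.
        exists z; split; [easy | now apply (ndom_at_iff _ _ (str_index KK k))]. }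
      assert (Hd' : Forall (dom (str KK k')) (dec (rlist x))).
      { apply Forall_forall; intros z Hz; apply NNPP; intros Hn; apply N; right; left.
        exists z; split; [easy | now apply (ndom_at_iff _ _ (str_index KK k'))]. }
      exists k, k'; repeat (split; [easy|]).
      apply NNPP; intros Hs; apply N; right; right.
      apply nsimeq_at_iff with (A := str KK k) (B := str KK k'); auto using str_index.
  - unfold ltriple, rtriple, llist, rlist.
    apply semidec_or; [apply semidec_not_triple; recursive_tac|].
    apply semidec_or; [apply semidec_not_triple; recursive_tac|].
    apply semidec_and; [apply semidec_is_triple; recursive_tac|].
    apply semidec_and; [apply semidec_is_triple; recursive_tac|].
    unfold ndom_at, triple_index.
    apply semidec_or; [semidec_tac|]; apply semidec_or; [semidec_tac|].
    apply semidec_nsimeq_at.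
    unfold EI_problem, problem, triple_index, ltriple, rtriple, llist, rlist.
    recursive_tac.
Qed.

Lemma semidec_EI : uniformly_finite (age_mem K) -> semidec (EI KK).
Proof.
  intros [[l Hl] (f & _ & Hf)].
  apply semidec_ext with (P := fun x => is_triple (ltriple x) /\ is_triple (rtriple x) /\
    Forall (dom_at (triple_index (ltriple x))) (dec (llist x)) /\
    Forall (dom_at (triple_index (rtriple x))) (dec (rlist x)) /\
    simeq_at L l (EI_problem x)).
  - assert (D : forall k, forall xs,
      Forall (dom_at (index KK k)) xs <-> Forall (dom (str KK k)) xs).
    { intros k xs; rewrite !Forall_forall; split; intros H z Hz;
        apply (dom_at_iff _ _ (str_index KK k)), H, Hz. }
    intros x; rewrite EI_iff; split.
    + intros ([k E] & [k' E'] & Hd & Hd' & Hs); unfold EI_problem in Hs.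
      rewrite E, triple_index_triple in *; rewrite E', triple_index_triple in *.
      apply D in Hd, Hd'; exists k, k'; repeat (split; [easy|]).
      apply simeq_at_sound with (6 := Hs); auto using str_index.
    + intros (k & k' & E & E' & Hd & Hd' & Hs); unfold EI_problem.
      rewrite E, E', !triple_index_triple, !D.
      do 2 (split; [eexists; reflexivity|]); do 2 (split; [easy|]).
      (* Uniform finiteness applies to both structures as members of the age and supplies their
         finite closures. *)
      eapply simeq_at_complete with (7 := Hs); eauto using str_index, str_mem.
  - unfold ltriple, rtriple, llist, rlist.
    apply semidec_and; [apply semidec_is_triple; recursive_tac|].
    apply semidec_and; [apply semidec_is_triple; recursive_tac|].
    unfold dom_at, triple_index.
    apply semidec_and; [semidec_tac|]; apply semidec_and; [semidec_tac|].
    apply semidec_simeq_at.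
    unfold EI_problem, problem, triple_index, ltriple, rtriple, llist, rlist.
    recursive_tac.
Qed.

End EmbeddingInformation.

Theorem lemma5p5 (L : language) (K : age L) (KK : computable_age K) :
  turing_le (EI KK) zero_jump /\
  (uniformly_finite (age_mem K) -> computable (EI KK)).
Proof.
  split.
  - apply semidec_compl_turing_le_zero_jump, semidec_compl_EI.
  - intros H; apply semidec_compl_computable; [now apply semidec_EI | apply semidec_compl_EI].
Qed.
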